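(* Let $\mathfrak g$ be a metric Lie algebra without simple ideals. Then $\mathfrak g$ has the structure of a balanced quadratic extension in a canonical way: for the canonical isotropic ideal $\mathfrak i(\mathfrak g)$ the quotient $\mathfrak i(\mathfrak g)^\perp/\mathfrak i(\mathfrak g)$ is abelian, so that the sequence $0\to\mathfrak i(\mathfrak g)^\perp/\mathfrak i(\mathfrak g)\to\mathfrak g/\mathfrak i(\mathfrak g)\to\mathfrak g/\mathfrak i(\mathfrak g)^\perp\to0$ (with the inclusion and the projection as maps) makes $\mathfrak g$, together with the ideal $\mathfrak i(\mathfrak g)$, a balanced quadratic extension of $\mathfrak g/\mathfrak i(\mathfrak g)^\perp$ by the orthogonal module $\mathfrak i(\mathfrak g)^\perp/\mathfrak i(\mathfrak g)$. This quadratic extension is regularly balanced if and only if $\mathfrak g$ does not contain a (non-zero) non-degenerate abelian ideal.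
   Context: All Lie algebras and modules are real and finite-dimensional. A metric Lie algebra is a Lie algebra with a non-degenerate invariant symmetric bilinear form. An ideal is non-degenerate if the restriction of the form to it is non-degenerate. An orthogonal $\mathfrak l$-module $(\rho,\mathfrak a,\langle\cdot,\cdot\rangle_{\mathfrak a})$ is a representation $\rho$ of $\mathfrak l$ on $\mathfrak a$ by skew-symmetric maps with respect to a non-degenerate symmetric bilinear form. $\mathfrak z(\mathfrak g)$ is the centre and $\mathfrak g'=[\mathfrak g,\mathfrak g]$. A quadratic extension of $\mathfrak l$ by $\mathfrak a$ is a quadruple $(\mathfrak g,\mathfrak i,i,p)$ where $\mathfrak g$ is a metric Lie algebra, $\mathfrak i\subset\mathfrak g$ an isotropic ideal, and $0\to\mathfrak a\stackrel{i}{\to}\mathfrak g/\mathfrak i\stackrel{p}{\to}\mathfrak l\to0$ is an exact sequence of Lie algebras ($\mathfrak a$ regarded as abelian) such that $i(\rho(L)A)=[\tilde L,i(A)]$ for all $A\in\mathfrak a$ and all $\tilde L$ with $p(\tilde L)=L$, $\mathrm{im}\,i=\mathfrak i^\perp/\mathfrak i$, and $i:\mathfrak a\to\mathfrak i^\perp/\mathfrak i$ is an isometry. For a finite-dimensional $\mathfrak g$-module $V$ the socle $S(V)$ is the maximal submodule on which $\mathfrak g$ acts semi-simply, and the radical $R(V)$ is the minimal submodule such that $V/R(V)$ is semi-simple. Put $S_0(V)=0$, $S_k(V)$ = preimage in $V$ of $S(V/S_{k-1}(V))$, $R_0(V)=V$, $R_k(V)=R(R_{k-1}(V))$. For the adjoint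 module $V=\mathfrak g$ define $\mathfrak i(\mathfrak g)=\sum_{k\ge1}R_k(\mathfrak g)\cap S_k(\mathfrak g)$ and $\mathfrak j(\mathfrak g)=\bigcap_{k\ge1}(R_k(\mathfrak g)+S_k(\mathfrak g))$. For a metric Lie algebra $\mathfrak g$ one has $\mathfrak i(\mathfrak g)^\perp=\mathfrak j(\mathfrak g)\supset\mathfrak i(\mathfrak g)$; $\mathfrak i(\mathfrak g)$ is called the canonical isotropic ideal. A quadratic extension $(\mathfrak g,\mathfrak i,i,p)$ is balanced if $\mathfrak i=\mathfrak i(\mathfrak g)$, and regularly balanced if in addition $\mathfrak z(\mathfrak g)\subset\mathfrak g'$. *)

(* Defs.v *)
From HB Require Import structures.
From mathcomp Require Import all_boot all_order all_algebra.
From mathcomp Require Import all_classical all_reals.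

Set Implicit Arguments.
Unset Strict Implicit.
Unset Printing Implicit Defensive.

Import GRing.Theory.
Local Open Scope ring_scope.

(* Span of an arbitrary, possibly infinite, set of vectors. *)
Section SetSpan.
Variables (K : fieldType) (V : vectType K).
Implicit Types (A : set V) (W : {vspace V}) (X : seq V).

Lemma setspan_exists A :
  exists X, (forall x, x \in X -> A x) /\ (forall x, A x -> x \in <<X>>%VS).
Proof.
pose P n := `[< exists X, (forall x, x \in X -> A x) /\ \dim <<X>> = n >].
have P0 : exists n, P n.
  by exists 0%N; apply/asboolP; exists [::]; rewrite span_nil dimv0.
have Pmax n : P n -> (n <= \dim {:V})%N.
  by move/asboolP => [X [_ <-]]; rewrite dimvS // subvf.
have [n /asboolP [X [XA dX]] nmax] := ex_maxnP P0 Pmax.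
exists X; split=> // x Ax.
have /nmax : P (\dim <<x :: X>>).
  apply/asboolP; exists (x :: X); split=> // y.
  by rewrite inE => /predU1P [-> //|]; exact: XA.
rewrite -dX span_cons => le.
have /eqP -> : (<<X>> == <[x]> + <<X>>)%VS by rewrite eqEdim addvSr.
by rewrite memvE addvSl.
Qed.

Definition setspan A : {vspace V} := << sval (cid (setspan_exists A)) >>%VS.

Lemma mem_setspan A x : A x -> x \in setspan A.
Proof. by rewrite /setspan; case: cid => X [XA AX] /= /AX. Qed.

Lemma setspan_subvP A W : (setspan A <= W)%VS <-> (forall x, A x -> x \in W).
Proof.
split=> [/subvP AW x Ax|AW]; first exact/AW/mem_setspan.
rewrite /setspan; case: cid => X [XA AX] /=.
by apply/span_subvP => x /XA /AW.
Qed.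

Definition sumseqv (U : nat -> {vspace V}) : {vspace V} :=
  setspan (fun v => exists k, v \in U k).

End SetSpan.

(* The quotient V / U, realised on the complement U^C of U chosen by the
   library; only the projection quotp and its kernel U matter.               *)
Section QuotientSpace.
Variables (K : fieldType) (V : vectType K) (U : {vspace V}).

Definition quotv : vectType K := subvs_of (U^C)%VS.

Definition quotp : 'Hom(V, quotv) :=
  (linfun (vsproj (U^C)%VS) \o daddv_pi (U^C)%VS U)%VF.

Definition quot_lift : 'Hom(quotv, V) := linfun (@vsval K V (U^C)%VS).

Let capC : (U^C :&: U = 0)%VS. Proof. by rewrite capvC capv_compl. Qed.

Let val_quotp x : vsval (quotp x) = daddv_pi (U^C)%VS U x.
Proof. by rewrite comp_lfunE lfunE /= vsprojK // memv_pi. Qed.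

Lemma quot_liftK : cancel quot_lift quotp.
Proof.
move=> u; apply: val_inj; rewrite /= val_quotp lfunE /=.
by rewrite daddv_pi_id // subvsP.
Qed.

Lemma quotpK x : quot_lift (quotp x) - x \in U.
Proof.
rewrite lfunE /= val_quotp -opprB rpredN.
have {1}-> : x = daddv_pi (U^C)%VS U x + daddv_pi U (U^C)%VS x.
  by rewrite daddv_pi_add // addvC addv_complf memvf.
by rewrite addrAC subrr add0r memv_pi.
Qed.

Lemma quotp_eq0 x : (quotp x == 0) = (x \in U).
Proof.
apply/eqP/idP => [qx0|xU].
  by have := quotpK x; rewrite qx0 linear0 sub0r rpredN.
have := quotpK x; rewrite rpredBr // => lU.
rewrite -[quotp x]quot_liftK; suff -> : quot_lift (quotp x) = 0.
  by rewrite linear0.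
apply/eqP; rewrite -memv0 -capC memv_cap lU andbT.
by rewrite lfunE /= subvsP.
Qed.

Lemma quotpP x y : quotp x = quotp y <-> x - y \in U.
Proof.
by rewrite -quotp_eq0 linearB /= subr_eq0; split=> /eqP // ->.
Qed.

Lemma lker_quotp : lker quotp = U.
Proof. by apply/vspaceP => x; rewrite memv_ker quotp_eq0. Qed.

Lemma limg_quotp : limg quotp = fullv.
Proof.
apply/eqP; rewrite eqEsubv subvf; apply/subvP => u _.
by rewrite -[u]quot_liftK memv_img ?memvf.
Qed.

End QuotientSpace.

Arguments quotv {K V} U.
Arguments quotp {K V} U.
Arguments quot_lift {K V} U.

Record lieAlgebra (K : fieldType) := LieAlgebra {
  lie_space :> vectType K;
  bracket : {bilinear lie_space -> lie_space -> lie_space};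
  bracketxx : forall x, bracket x x = 0;
  jacobi : forall x y z,
    bracket x (bracket y z) + bracket y (bracket z x)
      + bracket z (bracket x y) = 0
}.

Arguments bracket {K l}.
Notation "[ 'lie' x , y ]" := (bracket x y)
  (at level 0, x, y at level 99, format "[ 'lie'  x ,  y ]") : ring_scope.

Lemma bracketC (K : fieldType) (L : lieAlgebra K) (x y : L) :
  [lie x, y] = - [lie y, x].
Proof.
have := bracketxx (x + y).
rewrite linearDl !linearDr !bracketxx addr0 add0r => /eqP.
by rewrite addr_eq0 => /eqP.
Qed.

Record lieModule (K : fieldType) (L : lieAlgebra K) := LieModule {
  module_space :> vectType K;
  action : {bilinear L -> module_space -> module_space};
  action_bracket : forall x y v,
    action [lie x, y] v = action x (action y v) - action y (action x v)
}.

Arguments action {K L l}.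

Record submodule (K : fieldType) (L : lieAlgebra K) (M : lieModule L) :=
  Submodule {
    submodule_space :> {vspace M};
    submodule_stable : forall x v,
      v \in submodule_space -> action x v \in submodule_space
  }.

Section Modules.
Variables (K : fieldType) (L : lieAlgebra K) (M : lieModule L).
Implicit Types (U W : submodule M).

Section SubModule.
Variable U : submodule M.

Definition sub_action (x : L) (u : subvs_of U) : subvs_of U :=
  vsproj U (action x (vsval u)).

Lemma val_sub_action x u : vsval (sub_action x u) = action x (vsval u).
Proof. by rewrite vsprojK // submodule_stable // subvsP. Qed.

Lemma sub_action_bilinear : bilinear_for
  (GRing.Scale.Law.clone _ _ *:%R _) (GRing.Scale.Law.clone _ _ *:%R _)
  sub_action.
Proof.
by split=> [u|x] a y z; rewrite /sub_action /= ?(linearPl, linearPr) linearP.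
Qed.

HB.instance Definition _ :=
  bilinear_isBilinear.Build K L (subvs_of U) (subvs_of U) _ _ sub_action
    sub_action_bilinear.

Lemma sub_action_bracket x y u :
  sub_action [lie x, y] u
    = sub_action x (sub_action y u) - sub_action y (sub_action x u).
Proof.
apply: subvs_inj; rewrite val_sub_action action_bracket -!val_sub_action.
by [].
Qed.

Definition sub_module : lieModule L := LieModule sub_action_bracket.

End SubModule.

Section QuotModule.
Variable U : submodule M.

Definition quot_action (x : L) (u : quotv U) : quotv U :=
  quotp U (action x (quot_lift U u)).

Lemma quot_actionE x v : quot_action x (quotp U v) = quotp U (action x v).
Proof.
by apply/quotpP; rewrite -linearBr submodule_stable // quotpK.
Qed.

Lemma quot_action_bilinear : bilinear_for
  (GRing.Scale.Law.clone _ _ *:%R _) (GRing.Scale.Law.clone _ _ *:%R _)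
  quot_action.
Proof.
by split=> [u|x] a y z; rewrite /quot_action ?(linearPl, linearP) //= linearPr linearP.
Qed.

HB.instance Definition _ :=
  bilinear_isBilinear.Build K L (quotv U) (quotv U) _ _ quot_action
    quot_action_bilinear.

Lemma quot_action_bracket x y u :
  quot_action [lie x, y] u
    = quot_action x (quot_action y u) - quot_action y (quot_action x u).
Proof.
rewrite -[u]quot_liftK !quot_actionE action_bracket linearB //.
Qed.

Definition quot_module : lieModule L := LieModule quot_action_bracket.

End QuotModule.


Definition semisimple (N : lieModule L) :=
  forall U : submodule N, exists W : submodule N,
    (U + W = fullv)%VS /\ (U :&: W = 0)%VS.

Lemma submodule0_stable x v :
  v \in (0%VS : {vspace M}) -> action x v \in (0%VS : {vspace M}).
Proof. by rewrite !memv0 => /eqP ->; rewrite linear0r. Qed.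
Definition submodule0 : submodule M := Submodule submodule0_stable.

Lemma submodulef_stable x v :
  v \in (fullv : {vspace M}) -> action x v \in (fullv : {vspace M}).
Proof. by rewrite !memvf. Qed.
Definition submodulef : submodule M := Submodule submodulef_stable.

Lemma submoduleI_stable U W x v :
  v \in (U :&: W)%VS -> action x v \in (U :&: W)%VS.
Proof.
by rewrite !memv_cap => /andP [vU vW]; rewrite !submodule_stable.
Qed.
Definition submoduleI U W : submodule M := Submodule (@submoduleI_stable U W).

Lemma submoduleD_stable U W x v :
  v \in (U + W)%VS -> action x v \in (U + W)%VS.
Proof.
move=> /memv_addP [u uU [w wW ->]].
by rewrite linearDr memv_add // submodule_stable.
Qed.
Definition submoduleD U W : submodule M := Submodule (@submoduleD_stable U W).

Lemma submodule_sum_stable (U : nat -> submodule M) x v :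
  v \in sumseqv U -> action x v \in sumseqv U.
Proof.
move=> vS; rewrite -[action x v]/((action x : M -> M) v).
have -> : action x v = linfun (action x) v by rewrite lfunE.
rewrite memv_preim; move: v vS; apply/subvP/setspan_subvP => v [k vU].
rewrite -memv_preim lfunE /=; apply: mem_setspan; exists k.
exact: submodule_stable.
Qed.
Definition submodule_sum (U : nat -> submodule M) : submodule M :=
  Submodule (@submodule_sum_stable U).

End Modules.

Arguments submodulef {K L} M.
Arguments submodule0 {K L} M.

Section ModuleHom.
Variables (K : fieldType) (L : lieAlgebra K) (M N : lieModule L).
Variable f : 'Hom(M, N).
Hypothesis fM : forall x v, f (action x v) = action x (f v).

Lemma submodule_image_stable (W : submodule M) x v :
  v \in (f @: W)%VS -> action x v \in (f @: W)%VS.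
Proof.
by move=> /memv_imgP [w wW ->]; rewrite -fM memv_img // submodule_stable.
Qed.
Definition submodule_image (W : submodule M) : submodule N :=
  Submodule (@submodule_image_stable W).

Lemma submodule_preim_stable (W : submodule N) x v :
  v \in (f @^-1: W)%VS -> action x v \in (f @^-1: W)%VS.
Proof. by rewrite -!memv_preim fM => vW; exact: submodule_stable. Qed.
Definition submodule_preim (W : submodule N) : submodule M :=
  Submodule (@submodule_preim_stable W).

End ModuleHom.

Section Homs.
Variables (K : fieldType) (L : lieAlgebra K) (M : lieModule L).
Variable U : submodule M.

Definition sub_incl : 'Hom(sub_module U, M) := linfun (@vsval K M U).

Lemma sub_inclM x u : sub_incl (action x u) = action x (sub_incl u).
Proof. by rewrite !lfunE /= val_sub_action. Qed.

Lemma lker_sub_incl : lker sub_incl = 0%VS.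
Proof.
apply/eqP/lker0P => u w; rewrite !lfunE /=; exact: subvs_inj.
Qed.

Lemma limg_sub_incl : limg sub_incl = U.
Proof.
apply/vspaceP => v; apply/memv_imgP/idP => [[u _ ->]|vU].
  by rewrite lfunE /= subvsP.
by exists (vsproj U v); rewrite ?memvf // lfunE /= vsprojK.
Qed.

Definition quot_proj : 'Hom(M, quot_module U) := quotp U.

Lemma quot_projM x v : quot_proj (action x v) = action x (quot_proj v).
Proof. by rewrite -[RHS]/(quot_action x (quotp U v)) quot_actionE. Qed.

End Homs.

Section SocleRadicalExist.
Variables (K : fieldType) (L : lieAlgebra K) (M : lieModule L).
Implicit Types (A B U W C : submodule M).

Definition complemented A B := forall W, (A <= W)%VS -> (W <= B)%VS ->
  exists W', [/\ (A <= W')%VS, (W' <= B)%VS, (W + W' = B)%VS & (W :&: W' = A)%VS].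

Lemma exists_maxdim (P : submodule M -> Prop) U0 : P U0 ->
  exists2 U, P U & forall W, P W -> (\dim W <= \dim U)%N.
Proof.
move=> PU0; pose Q n := `[< exists2 U, P U & \dim U = n >].
have Q0 : exists n, Q n by exists (\dim U0); apply/asboolP; exists U0.
have Qmax n : Q n -> (n <= \dim {:M})%N.
  by move=> /asboolP [U _ <-]; rewrite dimvS // subvf.
have [n /asboolP [U PU <-] nmax] := ex_maxnP Q0 Qmax.
by exists U => // W PW; apply: nmax; apply/asboolP; exists W.
Qed.

Lemma exists_mindim (P : submodule M -> Prop) U0 : P U0 ->
  exists2 U, P U & forall W, P W -> (\dim U <= \dim W)%N.
Proof.
move=> PU0; pose Q n := `[< exists2 U, P U & \dim U = n >].
have Q0 : exists n, Q n by exists (\dim U0); apply/asboolP; exists U0.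
have [n /asboolP [U PU <-] nmin] := ex_minnP Q0.
by exists U => // W PW; apply: nmin; apply/asboolP; exists W.
Qed.

Lemma complementedD A B : complemented (submodule0 M) A ->
  complemented (submodule0 M) B ->
  complemented (submodule0 M) (submoduleD A B).
Proof.
move=> cA cB W _ /= WAB.
have P0 : (submodule0 M <= submoduleD A B)%VS /\ (W :&: submodule0 M = 0)%VS.
  by rewrite sub0v capv0.
have [W' [W'AB WW'0] W'max] := @exists_maxdim
  (fun W' => (W' <= submoduleD A B)%VS /\ (W :&: W' = 0)%VS) _ P0.
suff key D : complemented (submodule0 M) D -> (D <= A + B)%VS ->
    (D <= W + W')%VS.
  exists W'; split=> //=; first exact: sub0v.
  apply/eqP; rewrite eqEsubv !subv_add WAB W'AB /=.
  by rewrite !key ?addvSl ?addvSr.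
move=> cD DAB.
have [|C [_ CD DC CI]] := cD (submoduleI D (submoduleD W W')) (sub0v _).
  exact: capvSl.
rewrite /= in DC CI.
have CWW' : (C :&: (W + W') = 0)%VS.
  apply/eqP; rewrite -subv0 -CI subv_cap capvSl andbT.
  exact: capvS.
have PC : (submoduleD W' C <= submoduleD A B)%VS /\
    (W :&: submoduleD W' C = 0)%VS.
  split; first by rewrite /= subv_add W'AB (subv_trans CD DAB).
  apply/eqP; rewrite -subv0; apply/subvP => x /=.
  rewrite memv_cap => /andP [xW /memv_addP [w' w'W' [c cC xE]]].
  have c0 : c = 0.
    apply/eqP; rewrite -memv0 -CWW' memv_cap cC.
    have -> : c = x - w' by rewrite xE addrC addKr.
    by rewrite memv_add // rpredN.
  by rewrite -WW'0 memv_cap xW xE c0 addr0.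
have /= := W'max _ PC => dle.
have CW' : (C <= W')%VS.
  have /eqP -> : (W' == W' + C :> {vspace M})%VS by rewrite eqEdim addvSl.
  exact: addvSr.
have C0 : (C = 0 :> {vspace M})%VS.
  apply/eqP; rewrite -subv0 -CWW' subv_cap subvv.
  exact: subv_trans CW' (addvSr _ _).
by rewrite -DC C0 addv0 capvSr.
Qed.

Lemma complementedI A B : complemented A (submodulef M) ->
  complemented B (submodulef M) ->
  complemented (submoduleI A B) (submodulef M).
Proof.
move=> cA cB W /= ABW _.
have P0 : (submoduleI A B <= submodulef M)%VS /\ (W + submodulef M = fullv)%VS.
  by rewrite subvf addvf.
have [W' [ABW' WW'T] W'min] := @exists_mindim
  (fun W' => (submoduleI A B <= W')%VS /\ (W + W' = fullv)%VS) _ P0.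
suff key D : complemented D (submodulef M) -> (A :&: B <= D)%VS ->
    (W :&: W' <= D)%VS.
  exists W'; split=> //=; first exact: subvf.
  apply/eqP; rewrite eqEsubv !subv_cap ABW ABW' /=.
  by rewrite !key ?capvSl ?capvSr.
move=> cD ABD.
have [|C [DC _ CD CI]] := cD (submoduleD D (submoduleI W W')) _ (subvf _).
  exact: addvSl.
rewrite /= in CD CI.
have CT : (C + (W :&: W') = fullv)%VS.
  apply/eqP; rewrite eqEsubv subvf -CD subv_add subv_add.
  by rewrite (subv_trans DC (addvSl _ _)) addvSr addvSl.
have PC : (submoduleI A B <= submoduleI W' C)%VS /\
    (W + submoduleI W' C = fullv)%VS.
  split; first by rewrite /= subv_cap ABW' (subv_trans ABD DC).
  apply/eqP; rewrite eqEsubv subvf -WW'T subv_add addvSl /=.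
  have {1}-> : (W' = W' :&: C + (W :&: W') :> {vspace M})%VS.
    by rewrite vspace_modr ?capvSr // CT capvf.
  rewrite subv_add addvSr.
  exact: subv_trans (capvSl _ _) (addvSl _ _).
have /= := W'min _ PC => dle.
have W'C : (W' <= C)%VS.
  have /eqP <- : (W' :&: C == W' :> {vspace M})%VS by rewrite eqEdim capvSl.
  exact: capvSr.
rewrite -CI subv_cap addvSr.
exact: subv_trans (capvSr _ _) W'C.
Qed.

Lemma semisimple_subP U :
  semisimple (sub_module U) <-> complemented (submodule0 M) U.
Proof.
set f := sub_incl U; have fM := @sub_inclM _ _ _ U.
have f0 : lker f == 0%VS by rewrite lker_sub_incl.
have fU : limg f = U := limg_sub_incl U.
split=> [ss W _ WU|cU W].
  have [W' [WW'f WW'0]] := ss (submodule_preim fM W).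
  have fW : (f @: (f @^-1: W) = W)%VS by rewrite lpreimK // fU.
  have fS (X : {vspace sub_module U}) : (f @: X <= U)%VS.
    by apply: subv_trans (limgS f (subvf X)) _; rewrite fU.
  exists (submodule_image fM W'); split=> /=; first exact: sub0v.
  - exact: fS.
  - by rewrite -{1}fW -limgD WW'f fU.
  by rewrite -{1}fW -lker0_img_cap // WW'0 limg0.
have [||W' [_ W'U WW'U WW'0]] := cU (submodule_image fM W).
- exact: sub0v.
- by apply: subv_trans (limgS f (subvf _)) _; rewrite fU.
have fW' : (f @: (f @^-1: W') = W')%VS by rewrite lpreimK // fU.
exists (submodule_preim fM W'); split.
  by apply/eqP; rewrite -(eq_limg_ker0 _ _ f0) limgD fU fW' WW'U.
by apply/eqP; rewrite -(eq_limg_ker0 _ _ f0) lker0_img_cap // fW' limg0; apply/eqP.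
Qed.

Lemma semisimple_quotP U :
  semisimple (quot_module U) <-> complemented U (submodulef M).
Proof.
set q := quot_proj U; have qM := @quot_projM _ _ _ U.
have kq : lker q = U := lker_quotp U.
have qT : limg q = fullv := limg_quotp U.
have qK (W : {vspace M}) : (U <= W)%VS -> (q @^-1: (q @: W) = W)%VS.
  move=> UW; apply/vspaceP => v; rewrite -memv_preim.
  apply/idP/idP => [/memv_imgP [w wW /eqP]|]; last exact: memv_img.
  rewrite -subr_eq0 -linearB -memv_ker kq => /(subvP UW) vw.
  by rewrite -[v](subrK w) memvD.
have Kq (W : {vspace quot_module U}) : (q @: (q @^-1: W) = W)%VS.
  by rewrite lpreimK // qT subvf.
have preimI (W W' : {vspace quot_module U}) :
    (q @^-1: (W :&: W') = q @^-1: W :&: q @^-1: W')%VS.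
  by apply/vspaceP => v; rewrite -memv_preim !memv_cap -!memv_preim.
have Upre (W : {vspace quot_module U}) : (U <= q @^-1: W)%VS.
  by rewrite -{1}kq -lpreim0 lpreimS // sub0v.
split=> [ss W UW _|cU W].
  have [W' [WW'f WW'0]] := ss (submodule_image qM W).
  exists (submodule_preim qM W'); split=> //=; first exact: subvf.
    rewrite -[LHS]qK; last exact: subv_trans UW (addvSl _ _).
    by rewrite limgD Kq WW'f -qT qK // subvf.
  by rewrite -{1}[submodule_space W]qK // -preimI WW'0 lpreim0.
have [||W' [UW' _ WW'T WW'U]] := cU (submodule_preim qM W).
- exact: Upre.
- exact: subvf.
exists (submodule_image qM W'); split=> /=.
  by rewrite -[X in (X + _)%VS]Kq -limgD WW'T.
rewrite -[LHS]Kq preimI qK // WW'U.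
by apply/eqP; rewrite -lkerE kq.
Qed.

Lemma socle_exists : exists S : submodule M, semisimple (sub_module S) /\
  forall U, semisimple (sub_module U) -> (U <= S)%VS.
Proof.
have P0 : semisimple (sub_module (submodule0 M)).
  apply/semisimple_subP => W _ W0; exists (submodule0 M).
  split=> //=; last by rewrite capv0.
  by rewrite addv0; apply/eqP; rewrite -subv0.
have [S ssS Smax] := @exists_maxdim
  (fun S => semisimple (sub_module S)) _ P0; exists S; split=> // U ssU.
have /Smax /= le : semisimple (sub_module (submoduleD S U)).
  by apply/semisimple_subP; apply: complementedD; apply/semisimple_subP.
have /eqP -> : (S == S + U :> {vspace M})%VS by rewrite eqEdim addvSl.
exact: addvSr.
Qed.

Lemma radical_exists : exists S : submodule M, semisimple (quot_module S) /\
  forall U, semisimple (quot_module U) -> (S <= U)%VS.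
Proof.
have P0 : semisimple (quot_module (submodulef M)).
  apply/semisimple_quotP => W fW _; exists (submodulef M).
  split=> //=; first by rewrite addvf.
  by rewrite capvf; apply/eqP; rewrite eqEsubv subvf.
have [S ssS Smin] := @exists_mindim
  (fun S => semisimple (quot_module S)) _ P0; exists S; split=> // U ssU.
have /Smin /= le : semisimple (quot_module (submoduleI S U)).
  by apply/semisimple_quotP; apply: complementedI; apply/semisimple_quotP.
have /eqP <- : (S :&: U == S :> {vspace M})%VS by rewrite eqEdim capvSl.
exact: capvSr.
Qed.

End SocleRadicalExist.

Section SocleRadical.
Variables (K : fieldType) (L : lieAlgebra K).
Implicit Types M : lieModule L.

Definition socle M : submodule M := sval (cid (socle_exists M)).

Lemma socleP M : semisimple (sub_module (socle M)) /\
  forall U : submodule M, semisimple (sub_module U) -> (U <= socle M)%VS.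
Proof. exact: svalP (cid (socle_exists M)). Qed.

Definition radical M : submodule M := sval (cid (radical_exists M)).

Lemma radicalP M : semisimple (quot_module (radical M)) /\
  forall U : submodule M, semisimple (quot_module U) -> (radical M <= U)%VS.
Proof. exact: svalP (cid (radical_exists M)). Qed.

Fixpoint socle_series M (k : nat) : submodule M :=
  if k is j.+1 then
    let S := socle_series M j in
    submodule_preim (@quot_projM K L M S) (socle (quot_module S))
  else submodule0 M.

Fixpoint radical_series M (k : nat) : submodule M :=
  if k is j.+1 then
    let R := radical_series M j in
    submodule_image (@sub_inclM K L M R) (radical (sub_module R))
  else submodulef M.

End SocleRadical.

Section Adjoint.
Variables (K : fieldType) (L : lieAlgebra K).

Lemma adjoint_bracket (x y z : L) :
  [lie [lie x, y], z] = [lie x, [lie y, z]] - [lie y, [lie x, z]].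
Proof.
have /eqP := jacobi x y z.
by rewrite addr_eq0 (bracketC z x) linearNr (bracketC z) opprK => /eqP.
Qed.

Definition adjoint : lieModule L :=
  @LieModule K L L (@bracket K L) adjoint_bracket.

End Adjoint.

Notation ideal L := (submodule (adjoint L)).

Section Ideals.
Variables (K : fieldType) (L : lieAlgebra K).
Implicit Types (I J : ideal L) (U : {vspace L}).

Lemma ideal_stable I (x y : L) : y \in (I : {vspace L}) ->
  [lie x, y] \in (I : {vspace L}).
Proof. exact: (@submodule_stable _ _ _ I). Qed.

Lemma ideal_stabler I (x y : L) : x \in (I : {vspace L}) ->
  [lie x, y] \in (I : {vspace L}).
Proof. by move=> xI; rewrite bracketC rpredN ideal_stable. Qed.

Definition abelian U := forall x y : L, x \in U -> y \in U -> [lie x, y] = 0.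

Definition center : set L := fun x => forall y : L, [lie x, y] = 0.

Definition derived : {vspace L} :=
  setspan (fun z => exists x y : L, z = [lie x, y]).

(* The sum of all R_k \cap S_k with k >= 1. *)
Definition canonical_ideal : ideal L :=
  submodule_sum (fun k => submoduleI (radical_series (adjoint L) k.+1)
                                     (socle_series (adjoint L) k.+1)).

Section SubLie.
Variable I : ideal L.

Definition sub_bracket (u v : subvs_of I) : subvs_of I :=
  vsproj I [lie vsval u, vsval v].

Lemma val_sub_bracket u v : vsval (sub_bracket u v) = [lie vsval u, vsval v].
Proof. by rewrite vsprojK // ideal_stable // subvsP. Qed.

Lemma sub_bracket_bilinear : bilinear_for
  (GRing.Scale.Law.clone _ _ *:%R _) (GRing.Scale.Law.clone _ _ *:%R _)
  sub_bracket.
Proof.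
by split=> [u|x] a y z; rewrite /sub_bracket /= ?(linearPl, linearPr) linearP.
Qed.

HB.instance Definition _ :=
  bilinear_isBilinear.Build K (subvs_of I) (subvs_of I) (subvs_of I) _ _
    sub_bracket sub_bracket_bilinear.

Lemma sub_bracketxx u : sub_bracket u u = 0.
Proof. by apply: subvs_inj; rewrite val_sub_bracket bracketxx. Qed.

Lemma sub_jacobi u v w :
  sub_bracket u (sub_bracket v w) + sub_bracket v (sub_bracket w u)
    + sub_bracket w (sub_bracket u v) = 0.
Proof.
apply: subvs_inj; rewrite -[RHS](jacobi (vsval u) (vsval v) (vsval w)).
by rewrite -!val_sub_bracket.
Qed.

Definition sub_lie : lieAlgebra K := LieAlgebra sub_bracketxx sub_jacobi.

End SubLie.

Section QuotLie.
Variable I : ideal L.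

Definition quot_bracket (u v : quotv I) : quotv I :=
  quotp I [lie (quot_lift I u : L), (quot_lift I v : L)].

Lemma quot_bracketE (x y : L) :
  quot_bracket (quotp I x) (quotp I y) = quotp I [lie x, y].
Proof.
apply/quotpP; set x' := quot_lift _ _; set y' := quot_lift _ _.
have -> : [lie x', y'] - [lie x, y]
    = [lie x' - x, y'] + [lie x, y' - y] :> L.
  by rewrite linearBl linearBr addrA subrK.
by apply: rpredD; [apply: ideal_stabler|apply: ideal_stable]; exact: quotpK.
Qed.

Lemma quot_bracket_bilinear : bilinear_for
  (GRing.Scale.Law.clone _ _ *:%R _) (GRing.Scale.Law.clone _ _ *:%R _)
  quot_bracket.
Proof.
by split=> [u|x] a y z; rewrite /quot_bracket /= linearP ?(linearPl, linearPr) linearP.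
Qed.

HB.instance Definition _ :=
  bilinear_isBilinear.Build K (quotv I) (quotv I) (quotv I) _ _
    quot_bracket quot_bracket_bilinear.

Lemma quot_bracketxx u : quot_bracket u u = 0.
Proof. by rewrite /quot_bracket bracketxx linear0. Qed.

Lemma quot_jacobi u v w :
  quot_bracket u (quot_bracket v w) + quot_bracket v (quot_bracket w u)
    + quot_bracket w (quot_bracket u v) = 0.
Proof.
rewrite -[u]quot_liftK -[v]quot_liftK -[w]quot_liftK !quot_bracketE.
by rewrite -!linearD jacobi linear0.
Qed.

Definition quot_lie : lieAlgebra K := LieAlgebra quot_bracketxx quot_jacobi.

End QuotLie.

Lemma quot_ideal_stable I J (x y : quot_lie I) :
  y \in (quotp I @: J)%VS -> [lie x, y] \in (quotp I @: J)%VS.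
Proof.
move=> /memv_imgP [z zJ ->]; rewrite -[x]quot_liftK.
rewrite -[X in X \in _]/(quot_bracket _ _) quot_bracketE.
exact: memv_img (ideal_stable _ zJ).
Qed.

(* The ideal (I + J) / I of L / I. *)
Definition quot_ideal I J : ideal (quot_lie I) :=
  @Submodule K (quot_lie I) (adjoint (quot_lie I)) _ (@quot_ideal_stable I J).

End Ideals.

Arguments quot_lie {K L} I.
Arguments sub_lie {K L} I.
Arguments canonical_ideal {K} L.
Arguments center {K} L.
Arguments derived {K} L.

Definition simple_lie (K : fieldType) (L : lieAlgebra K) : Prop :=
  ~ abelian (fullv : {vspace L}) /\
  forall I : ideal L, (I = 0 :> {vspace L})%VS \/ (I = fullv :> {vspace L})%VS.

Record metricLieAlgebra (K : fieldType) := MetricLieAlgebra {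
  metric_lie :> lieAlgebra K;
  metric : {symmetric metric_lie};
  metric_nondegenerate : nondegenerate metric;
  metric_invariant : forall x y z : metric_lie,
    metric [lie x, y] z = metric x [lie y, z]
}.

Arguments metric {K m}.

Record orthModule (K : fieldType) (L : lieAlgebra K) := OrthModule {
  orth_module :> lieModule L;
  orth_form : {symmetric orth_module};
  orth_nondegenerate : nondegenerate orth_form;
  orth_skew : forall (x : L) (a b : orth_module),
    orth_form (action x a) b = - orth_form a (action x b)
}.

Arguments orth_form {K L o}.

Section Orthov.
Variables (K : fieldType) (V : vectType K) (f : {symmetric V}).
Implicit Types U W : {vspace V}.

Lemma dim_cap_orthov U W : (\dim W <= \dim (W :&: orthov f U) + \dim U)%N.
Proof.
pose g x : 'rV[K]_(\dim U) := \row_i f x (vbasis U)`_i.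
have gL : linear g.
  by move=> a x y; apply/rowP => i; rewrite !mxE linearPl.
pose gl := linfun (HB.pack g (GRing.isLinear.Build K V _ _ g gL)
                     : {linear V -> 'rV[K]_(\dim U)}).
rewrite -(limg_ker_dim gl W) leq_add //; last first.
  rewrite (leq_trans (dimvS (subvf _))) // dimvf dim_matrix.
  exact: eq_leq (mul1n _).
apply: dimvS; apply: capvS => //; apply/subvP => x.
rewrite memv_ker lfunE /= => /eqP gx0; apply/mem_orthovP => u.
move=> /coord_vbasis ->; rewrite linear_sumr big1 // => i _.
by move/rowP/(_ i): gx0; rewrite !mxE linearZr => /= ->; rewrite mulr0.
Qed.

Lemma symC x y : f x y = f y x.
Proof. by rewrite hermC /= expr0 mul1r. Qed.

Lemma formDr x y z : f x (y + z) = f x y + f x z. Proof. exact: linearDr. Qed.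
Lemma formNl x y : f (- x) y = - f x y. Proof. exact: linearNl. Qed.
Lemma formBl x y z : f (x - y) z = f x z - f y z. Proof. exact: linearBl. Qed.

Hypothesis f_nd : nondegenerate f.

Lemma dim_orthov U : (\dim (orthov f U) + \dim U = \dim {:V})%N.
Proof.
apply/eqP; rewrite eqn_leq; apply/andP; split; last first.
  by have := dim_cap_orthov U fullv; rewrite capfv.
have := dim_cap_orthov ((orthov f U)^C)%VS U.
have -> : (U :&: orthov f (orthov f U)^C = 0)%VS.
  apply/eqP; rewrite -subv0 -(eqP f_nd); apply/subvP => x.
  rewrite memv_cap => /andP [xU /mem_orthovP xC]; apply/mem_orthovP => y.
  rewrite -(addv_complf (orthov f U)) => /memv_addP [a /mem_orthovP aU].
  by move=> [b bC ->]; rewrite formDr symC aU // xC // addr0.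
rewrite dimv0 add0n dimv_compl => le.
have dle : (\dim (orthov f U) <= \dim {:V})%N by rewrite dimvS ?subvf.
by rewrite -(subnKC dle) leq_add2l.
Qed.

Lemma orthovK U : orthov f (orthov f U) = U.
Proof.
apply/esym/eqP; rewrite eqEdim; apply/andP; split.
  by apply/orthovP => u v uU /mem_orthovP vU; rewrite symC vU.
rewrite -(leq_add2r (\dim (orthov f U))) dim_orthov.
by rewrite [X in (_ <= X)%N]addnC dim_orthov.
Qed.

End Orthov.

Section Perp.
Variables (K : fieldType) (g : metricLieAlgebra K).

Lemma perp_stable (I : ideal g) (x y : g) :
  y \in orthov metric I -> [lie x, y] \in orthov metric I.
Proof.
move=> /mem_orthovP yI; apply/mem_orthovP => z zI.
by rewrite bracketC formNl metric_invariant yI ?oppr0 // ideal_stable.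
Qed.

Definition perp (I : ideal g) : ideal g :=
  @Submodule K g (adjoint g) _ (@perp_stable I).

Definition isotropic (I : ideal g) := (I <= perp I)%VS.

Definition nondegenerate_on (U : {vspace g}) :=
  forall x : g, x \in U -> (forall y : g, y \in U -> metric x y = 0) -> x = 0.

(* I^\perp / I as an ideal of g / I *)
Definition perp_quot (I : ideal g) : ideal (quot_lie I) :=
  quot_ideal I (perp I).

(* g / I -> g / I^\perp, the map induced by the projection *)
Definition perp_proj (I : ideal g) : 'Hom(quot_lie I, quot_lie (perp I)) :=
  (quotp (perp I) \o quot_lift I)%VF.

End Perp.

(* The orthogonal g / I^\perp-module I^\perp / I; the action and the form are
   computed on representatives.                                              *)
Section PerpModule.
Variables (K : fieldType) (g : metricLieAlgebra K) (I : ideal g).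

Local Notation A := (subvs_of (perp_quot I)).

Definition perp_action (l : quot_lie (perp I)) (u : A) : A :=
  vsproj (perp_quot I)
    [lie (quotp I (quot_lift (perp I) l) : quot_lie I), vsval u].

Definition perp_form (u v : A) : K :=
  metric (quot_lift I (vsval u) : g) (quot_lift I (vsval v) : g).

Lemma perp_action_bilinear : bilinear_for
  (GRing.Scale.Law.clone _ _ *:%R _) (GRing.Scale.Law.clone _ _ *:%R _)
  perp_action.
Proof.
split=> [u|x] a y z; rewrite /perp_action /=.
  by rewrite !linearP linearPl linearP.
by rewrite linearPr linearP.
Qed.

HB.instance Definition _ :=
  bilinear_isBilinear.Build K (quot_lie (perp I)) A A _ _
    perp_action perp_action_bilinear.

Lemma perp_form_bilinear : bilinear_for
  (GRing.Scale.Law.clone _ _ *%R _) (GRing.Scale.Law.clone _ _ (idfun \; *%R) _)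
  perp_form.
Proof.
split=> [u|x] a y z; rewrite /perp_form /= !linearP //.
exact: linearPl.
Qed.

HB.instance Definition _ :=
  bilinear_isBilinear.Build K A A K _ _ perp_form perp_form_bilinear.

Lemma perp_form_sym u v : perp_form u v = (-1) ^+ false * idfun (perp_form v u).
Proof. by rewrite /perp_form expr0 mul1r symC. Qed.

HB.instance Definition _ :=
  isHermitianSesquilinear.Build K A false idfun perp_form perp_form_sym.

Hypothesis I_iso : isotropic I.

Lemma perp_lift u : u \in (perp_quot I : {vspace quot_lie I}) ->
  quot_lift I u \in (perp I : {vspace g}).
Proof.
move=> /memv_imgP [x xP ->]; rewrite -[quot_lift _ _](subrK x).
by rewrite memvD // (subvP I_iso) // quotpK.
Qed.

Lemma perp_formE (x y : g) u v :
  x \in (perp I : {vspace g}) -> quotp I x = vsval u -> quotp I y = vsval v ->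
  perp_form u v = metric x y.
Proof.
move=> xP xu yv; rewrite /perp_form -xu -yv.
have vP : quot_lift I (quotp I y) \in (perp I : {vspace g}).
  by rewrite yv perp_lift // subvsP.
rewrite -[quot_lift I (quotp I x)](subrK x) symC formDr symC.
have := quotpK I x; have := quotpK I y.
move: (quot_lift I (quotp I x) - x) => i.
move: (quot_lift I (quotp I y)) vP => y' /mem_orthovP y'P y'y iI.
rewrite [X in X + _]symC y'P // add0r -[y'](subrK y) symC formDr.
by rewrite (mem_orthovP xP) // add0r.
Qed.

Lemma perp_nondegenerate : nondegenerate (@perp_form).
Proof.
rewrite /nondegenerate -subv0; apply/subvP => u /mem_orthovP u0.
rewrite memv0; apply/eqP/subvs_inj.
have [x xP xu] := memv_imgP (subvsP u); rewrite xu.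
apply/eqP; rewrite quotp_eq0.
rewrite -(orthovK (metric_nondegenerate g) I).
apply/mem_orthovP => y yP.
have yA : quotp I y \in perp_quot I by exact: memv_img.
rewrite -(u0 (vsproj (perp_quot I) (quotp I y)) (memvf _)); apply/esym.
by apply: perp_formE; rewrite ?vsprojK.
Qed.

Hypothesis ab : abelian (perp_quot I).

Lemma val_perp_action (x : g) u :
  vsval (perp_action (quotp (perp I) x) u)
    = [lie (quotp I x : quot_lie I), vsval u].
Proof.
rewrite vsprojK; last exact/ideal_stable/subvsP.
apply/eqP; rewrite -subr_eq0 -linearBl -linearB; apply/eqP.
by apply: ab; [apply: memv_img; exact: quotpK|exact: subvsP].
Qed.

Lemma perp_action_bracket x y u :
  perp_action [lie x, y] u
    = perp_action x (perp_action y u) - perp_action y (perp_action x u).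
Proof.
rewrite -(quot_liftK x) -(quot_liftK y).
move: (quot_lift _ x) (quot_lift _ y) => {}x {}y.
have -> : [lie (quotp (perp I) x : quot_lie (perp I)), quotp (perp I) y]
  = quotp (perp I) [lie x, y] by exact: quot_bracketE.
apply: subvs_inj; rewrite val_perp_action.
have -> : quotp I [lie x, y] = [lie (quotp I x : quot_lie I), quotp I y].
  by rewrite -[RHS]/(quot_bracket _ _) quot_bracketE.
by rewrite adjoint_bracket -!val_perp_action.
Qed.

Definition perp_lieModule : lieModule (quot_lie (perp I)) :=
  LieModule perp_action_bracket.

Lemma perp_skew x (u v : A) :
  perp_form (perp_action x u) v = - perp_form u (perp_action x v).
Proof.
rewrite -(quot_liftK x); move: (quot_lift _ x) => x'.
have [y yP yu] := memv_imgP (subvsP u).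
have [z zP zv] := memv_imgP (subvsP v).
have E w t : vsval t = quotp I w ->
    quotp I [lie x', w] = vsval (perp_action (quotp (perp I) x') t).
  move=> tw; rewrite val_perp_action tw.
  by rewrite -[RHS]/(quot_bracket _ _) quot_bracketE.
rewrite (perp_formE _ (E _ _ yu) (esym zv)); last exact: (ideal_stable _ yP).
rewrite (perp_formE _ (esym yu) (E _ _ zv)) //.
by rewrite bracketC formNl metric_invariant.
Qed.

Definition perp_module : orthModule (quot_lie (perp I)) :=
  @OrthModule K (quot_lie (perp I)) perp_lieModule (@perp_form)
    perp_nondegenerate perp_skew.

End PerpModule.


Section QuadraticExtension.
Variables (K : fieldType) (L : lieAlgebra K) (A : orthModule L).
Variables (g : metricLieAlgebra K) (I : ideal g).
Variables (i : 'Hom(A, quot_lie I)) (p : 'Hom(quot_lie I, L)).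

Record quadratic_extension : Prop := QuadraticExtension {
  qe_isotropic : isotropic I;
  (* i is a homomorphism from the abelian Lie algebra A *)
  qe_i_hom : forall a b : A, [lie i a, i b] = 0;
  qe_p_hom : forall u v : quot_lie I, p [lie u, v] = [lie p u, p v];
  qe_i_inj : lker i = 0%VS;
  qe_exact : limg i = lker p;
  qe_p_surj : limg p = fullv;
  qe_action : forall (l : L) (a : A) (l' : quot_lie I),
    p l' = l -> i (action l a) = [lie l', i a];
  qe_image : limg i = perp_quot I;
  qe_isometry : forall (a b : A) (x y : g),
    x \in (perp I : {vspace g}) -> y \in (perp I : {vspace g}) ->
    quotp I x = i a -> quotp I y = i b -> metric x y = orth_form a b
}.

Definition balanced : Prop :=
  quadratic_extension /\ (I = canonical_ideal g :> {vspace g}).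

Definition regularly_balanced : Prop :=
  balanced /\ forall x : g, center g x -> x \in derived g.

End QuadraticExtension.

Section CanonicalMaps.
Variables (K : fieldType) (g : metricLieAlgebra K) (I : ideal g).

(* The inclusion I^\perp / I -> g / I. *)
Definition perp_incl (iso : isotropic I) (ab : abelian (perp_quot I)) :
    'Hom(perp_module iso ab, quot_lie I) :=
  linfun (@vsval K (quot_lie I) (perp_quot I)).

Lemma perp_projE (iso : isotropic I) (x : g) :
  perp_proj I (quotp I x) = quotp (perp I) x.
Proof. by rewrite comp_lfunE; apply/quotpP; rewrite (subvP iso) // quotpK. Qed.

End CanonicalMaps.

Arguments quadratic_extension {K L} A {g} I i p.
Arguments balanced {K L} A {g} I i p.
Arguments regularly_balanced {K L} A {g} I i p.

(* Main.v *)
(* Write S_k and R_k for the socle and radical series of g, so that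
   R_k = S_k^perp, I for the canonical ideal and J = I^perp.  Then I is
   isotropic, J <= R_k + S_k, and by modularity I contains the intersection of
   the R_(k+1) + S_k.  Hence [J, J] <= I as soon as J acts trivially on every
   R_k / R_(k+1); as J <= R_1 + S_1, it is enough that R_1 and S_1 act
   nilpotently on g.  Without simple ideals S_1 is abelian: a minimal ideal is
   isotropic, hence abelian, or it splits off as an orthogonal factor, hence is
   simple if it is not abelian.  With D = [g, g] and E its orthogonal for the
   Killing form, Cartan's criterion and Engel's theorem show that D :&: E acts
   nilpotently and that g / D and g / E are semisimple modules, so that
   R_1 <= D :&: E.
   For the last equivalence, g' = z(g)^perp: a non-degenerate abelian ideal is
   central, and conversely if z(g) is not in g' then by polarisation some central
   v has <v, v> <> 0 and spans such an ideal. *)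
From HB Require Import structures.
Require Import Defs.
From mathcomp Require Import all_boot all_order all_algebra.
From mathcomp Require Import all_classical all_reals.
From mathcomp Require Import complex.

Set Implicit Arguments.
Unset Strict Implicit.
Unset Printing Implicit Defensive.

Import Order.TTheory GRing.Theory Num.Theory passmx.
Local Open Scope ring_scope.

(** * Nilpotency of a commutator from vanishing traces *)

Lemma coprimep_XsubC_exp_prod (F : fieldType) (a : F) (s : seq F) N :
  a \notin s ->
  coprimep (('X - a%:P) ^+ N) (\prod_(r <- s) ('X - r%:P) ^+ N).
Proof.
elim: s => [|b s IH]; first by rewrite big_nil coprimep1.
rewrite inE negb_or big_cons => /andP [ab /IH cs].
rewrite coprimepMr cs andbT coprimep_expl // coprimep_expr //.
by rewrite coprimep_XsubC root_XsubC eq_sym.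
Qed.

Lemma prod_XsubC_exp_dvdp (F : fieldType) (s : seq F) N (p : {poly F}) :
  uniq s -> (forall r, r \in s -> ('X - r%:P) ^+ N %| p) ->
  \prod_(r <- s) ('X - r%:P) ^+ N %| p.
Proof.
elim: s => [_ _|b s IH /= /andP [bs us] dp]; first by rewrite big_nil dvd1p.
rewrite big_cons Gauss_dvdp ?coprimep_XsubC_exp_prod //.
by rewrite dp ?mem_head // IH // => r rs; rewrite dp // inE rs orbT.
Qed.

(** The Chinese remainder theorem for the coprime moduli ('X - r)^N, adding one node at a time. *)
Lemma chinese_interpolation (F : fieldType) (s : seq F) N (phi : F -> F) :
  exists p : {poly F}, forall r, r \in s -> ('X - r%:P) ^+ N %| p - (phi r)%:P.
Proof.
elim: s => [|a s [p IH]]; first by exists 0.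
have [as'|as'] := boolP (a \in s).
  by exists p => r; rewrite inE => /predU1P [->|]; apply: IH.
have /Bezout_eq1_coprimepP [[u v] /= uv] := coprimep_XsubC_exp_prod N as'.
set f := \prod_(r <- s) _ in uv.
(* By Bezout [v * f] is 1 modulo the new factor and 0 modulo the old ones, so the correction only
   acts at [a]. *)
exists (p + ((phi a)%:P - p) * (v * f)) => r; rewrite inE => /predU1P [->|rs].
  have -> : v * f = 1 - u * ('X - a%:P) ^+ N by rewrite -uv addrC addKr.
  rewrite mulrBr mulr1 addrA [p + _]addrC subrK addrAC subrr add0r dvdpNr.
  by rewrite mulrA dvdp_mulIr.
rewrite addrAC dvdp_addr ?IH // !dvdp_mull //.
by rewrite /f (big_rem r) //= dvdp_mulIl.
Qed.


(** For a full-rank factorisation E = P Q, idempotency reads P Q P Q = P Q. Cancelling the outer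
    factors leaves Q P = 1, whose size is the rank and whose trace is that of [E]. *)
Lemma mxtrace_idempotent (F : fieldType) n (E : 'M[F]_n) :
  E *m E = E -> \tr E = (\rank E)%:R.
Proof.
move=> EE; suff BC : row_base E *m col_base E = 1%:M.
  by rewrite -{1}(mulmx_base E) mxtrace_mulC BC mxtrace1.
apply: (row_free_inj (row_base_free E)); apply: (row_full_inj (col_base_full E)).
move: (col_base E) (row_base E) (mulmx_base E) => P Q PQ /=.
by rewrite mul1mx !mulmxA PQ -mulmxA PQ.
Qed.

Lemma mulmx_expS (R : pzRingType) m n (P : 'M[R]_(m, n)) (Q : 'M[R]_(n, m)) k :
  (P *m Q) ^+ k.+1 = P *m (Q *m P) ^+ k *m Q.
Proof.
elim: k => [|k IH]; first by rewrite expr1 expr0 mulmx1.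
by rewrite exprSr IH [in RHS]exprSr -!mulmxE !mulmxA.
Qed.

(** Induction on the exponent, over all sizes: if A = P Q has full-rank factors, then Q P has the
    same trace, and A^(k+1) = P (Q P)^k Q = 0 forces (Q P)^k = 0. *)
Lemma mxtrace_nilpotent (F : fieldType) n (A : 'M[F]_n) k :
  A ^+ k = 0 -> \tr A = 0.
Proof.
elim: k n A => [|k IH] n A Ak0.
  by rewrite -[A]mul1r -(expr0 A) Ak0 mul0r mxtrace0.
have PQ := mulmx_base A; move: (col_base_full A) (row_base_free A).
move: (col_base A) (row_base A) PQ => P Q PQ Pf Qf.
rewrite -PQ mxtrace_mulC; apply: (IH).
apply: (row_full_inj Pf); apply: (row_free_inj Qf).
by rewrite /= -mulmx_expS PQ Ak0 mulmx0 mul0mx.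
Qed.

(** Each [E r] is a polynomial in [z], congruent to 1 modulo ('X - r)^N and to 0 modulo the powers
    at the other roots. It commutes with [z], and the other identities hold modulo the product of
    these powers, which annihilates [z] by Cayley-Hamilton. *)
Lemma spectral_projections (C : closedFieldType) n (z : 'M[C]_n.+1) :
  exists (s : seq C) (N : nat) (E : C -> 'M[C]_n.+1),
    [/\ uniq s /\ (0 < N)%N, \sum_(r <- s) E r = 1,
        forall r t, r \in s -> t \in s -> E r * E t = if r == t then E r else 0,
        forall r, r \in s -> E r * z = z * E r
      & forall r, r \in s -> (z - r%:M) ^+ N * E r = 0].
Proof.
have [rs zE] := closed_field_poly_normal (char_poly z).
rewrite (monicP (char_poly_monic z)) scale1r in zE.
(* [N] is positive and exceeds every multiplicity, so that [char_poly z] divides [f]. *)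
pose s := undup rs; pose N := (size rs).+1.
pose f := \prod_(r <- s) ('X - r%:P) ^+ N.
have fz p : f %| p -> horner_mx z p = 0.
  move=> fp; suff /dvdp_trans/(_ fp) : char_poly z %| f.
    by case/dvdpP => q ->; rewrite rmorphM /= Cayley_Hamilton mulr0.
  rewrite zE /f prodrXl.
  have dvd l : {subset l <= s} ->
      \prod_(r <- l) ('X - r%:P) %| (\prod_(r <- s) ('X - r%:P)) ^+ size l.
    elim: l => [|a l IH] ls; first by rewrite big_nil dvd1p.
    rewrite big_cons exprS dvdp_mul //.
      by rewrite (big_rem a) ?ls ?mem_head //= dvdp_mulIl.
    by apply: IH => x xl; rewrite ls // inE xl orbT.
  apply: dvdp_trans (dvd rs _) _; first by move=> x; rewrite mem_undup.
  by rewrite /N exprS dvdp_mulIr.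
have us : uniq s by exact: undup_uniq.
pose e r := sval (cid (chinese_interpolation s N (fun t => (t == r)%:R))).
have eP r t : t \in s -> ('X - t%:P) ^+ N %| e r - ((t == r)%:R)%:P.
  by rewrite /e; case: cid => p /= pP; exact: pP.
have e0 r t : t \in s -> t != r -> ('X - t%:P) ^+ N %| e r.
  by move=> ts tr; have := eP r t ts; rewrite (negPf tr) subr0.
exists s, N, (fun r => horner_mx z (e r)); split=> //.
- apply/eqP; rewrite -subr_eq0 -rmorph_sum -(rmorph1 (horner_mx z)) -rmorphB.
  apply/eqP/fz/prod_XsubC_exp_dvdp => // r rs'.
  rewrite (bigD1_seq r) //= addrAC dvdp_addr.
    rewrite big_seq_cond.
    apply: (big_ind (dvdp (('X - r%:P) ^+ N))) => [||t /andP [ts tr]].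
    + exact: dvdp0.
    + by move=> ? ?; exact: dvdp_add.
    by apply: e0; rewrite // eq_sym.
  by have := eP r r rs'; rewrite eqxx.
- move=> r t rs' ts; have [<-|rt] := eqVneq.
    apply/eqP; rewrite -subr_eq0 -rmorphM -rmorphB; apply/eqP/fz.
    apply: prod_XsubC_exp_dvdp => // q qs.
    have -> : e r * e r - e r = e r * (e r - 1) by rewrite mulrBr mulr1.
    have [->|qr] := eqVneq q r.
      by rewrite dvdp_mull //; have := eP r r rs'; rewrite eqxx.
    by rewrite dvdp_mulr // e0.
  rewrite -rmorphM; apply/fz/prod_XsubC_exp_dvdp => // q qs.
  have [->|qr] := eqVneq q r; first by rewrite dvdp_mull // e0.
  by rewrite dvdp_mulr // e0.
- by move=> r _; apply: comm_horner_mx.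
move=> r rs'.
have -> : z - r%:M = horner_mx z ('X - r%:P).
  by rewrite rmorphB /= horner_mx_X horner_mx_C.
rewrite -rmorphXn -rmorphM; apply/fz/prod_XsubC_exp_dvdp => // q qs.
have [->|qr] := eqVneq q r; first by rewrite dvdp_mulIl.
by rewrite dvdp_mull // e0.
Qed.

Lemma lin_mx_eqP (F : fieldType) n (A B : 'M[F]_(n * n)) :
  (forall a : 'M[F]_n, mxvec a *m A = mxvec a *m B) -> A = B.
Proof.
move=> AB; apply/row_matrixP => i; rewrite !rowE.
by rewrite -[delta_mx 0 i]vec_mxK AB.
Qed.

(** * Polynomials in ad z *)

Section AdInterpolation.
Variables (C : numClosedFieldType) (n : nat) (z : 'M[C]_n.+1).

(* [ad] acts on row-vectorised matrices by a |-> a z - z a. *)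
Let ad : 'M[C]_(n.+1 * n.+1) := lin_mulmxr z - lin_mulmx z.

Lemma mxvec_adX k a :
  mxvec a *m ad ^+ k = mxvec (iter k (fun b => b * z - z * b) a).
Proof.
elim: k => [|k IH]; first by rewrite expr0 mulmx1.
by rewrite exprSr -mulmxE mulmxA IH mulmxBr !mul_vec_lin /= -linearB.
Qed.

(** The shifted operator is the difference of right multiplication by z - t and left multiplication
    by z - r. These commute, so every term of the binomial expansion of the power N + N contains the
    N-th power of one of them, and both N-th powers kill [b]. *)
Lemma ad_shift_nilpotent (r t : C) N (b : 'M[C]_n.+1) :
  (z - r%:M) ^+ N * b = 0 -> b * (z - t%:M) ^+ N = 0 ->
  mxvec b *m (ad - (t - r)%:M) ^+ (N + N) = 0.
Proof.
move=> rb bt.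
pose Rt : 'M[C]_(n.+1 * n.+1) := lin_mulmxr (z - t%:M).
pose Lr : 'M[C]_(n.+1 * n.+1) := lin_mulmx (z - r%:M).
have -> : ad - (t - r)%:M = Rt - Lr.
  apply: lin_mx_eqP => a; rewrite !mulmxBr !mul_vec_lin /= mul_mx_scalar.
  rewrite -!linearZ -!linearB /=; congr mxvec.
  rewrite mulmxBr mulmxBl mul_mx_scalar mul_scalar_mx scalerBl !opprB.
  by rewrite addrACA [RHS]addrACA [- (z *m a) + _]addrC.
have RtX k a : mxvec a *m Rt ^+ k = mxvec (a * (z - t%:M) ^+ k).
  elim: k => [|k IH]; first by rewrite !expr0 mulmx1 mulr1.
  by rewrite !exprSr -mulmxE mulmxA IH mul_vec_lin /= mulmxE mulrA.
have LrX k a : mxvec a *m Lr ^+ k = mxvec ((z - r%:M) ^+ k * a).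
  elim: k => [|k IH]; first by rewrite !expr0 mulmx1 mul1r.
  by rewrite exprSr exprS -mulmxE mulmxA IH mul_vec_lin /= !mulmxE mulrA.
have cRL : GRing.comm Rt Lr.
  apply: lin_mx_eqP => a; rewrite -!mulmxE !mulmxA.
  have RtE b' : mxvec b' *m Rt = mxvec (b' *m (z - t%:M)) by exact: mul_vec_lin.
  have LrE b' : mxvec b' *m Lr = mxvec ((z - r%:M) *m b') by exact: mul_vec_lin.
  by rewrite RtE !LrE RtE mulmxA.
rewrite exprBn_comm // mulmx_sumr big1 // => i _.
suff b0 : mxvec b *m (Rt ^+ (N + N - i) * Lr ^+ i) = 0.
  rewrite -mulrA -signr_odd mulr_sign raddfMn /=.
  by case: odd; rewrite ?mulmxN b0 ?oppr0 mul0rn.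
have [iN|Ni] := ltnP i N.
  rewrite -addnBA ?(ltnW iN) // exprD -!mulmxE !mulmxA RtX bt.
  by rewrite linear0 !mul0mx.
rewrite commrX; last exact/commr_sym/commrX.
rewrite -(subnKC Ni) exprD -!mulmxE !mulmxA LrX rb.
by rewrite linear0 !mul0mx.
Qed.

Definition horner_ad (p : {poly C}) (a : 'M[C]_n.+1) : 'M[C]_n.+1 :=
  vec_mx (mxvec a *m (horner_mx ad p : 'M[C]_(n.+1 * n.+1))).

Lemma horner_ad_sum p (I : Type) (l : seq I) (F : I -> 'M[C]_n.+1) :
  horner_ad p (\sum_(i <- l) F i) = \sum_(i <- l) horner_ad p (F i).
Proof. by rewrite /horner_ad linear_sum mulmx_suml linear_sum. Qed.

(** As [p] is constant to order [M] at [mu], the nilpotent part of [ad] on a generalised eigenvector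
    contributes nothing. *)
Lemma horner_ad_eigen (mu c : C) M (p : {poly C}) (b : 'M[C]_n.+1) :
  ('X - mu%:P) ^+ M %| p - c%:P -> mxvec b *m (ad - mu%:M) ^+ M = 0 ->
  horner_ad p b = c *: b.
Proof.
move=> /dvdpP [q pE] b0.
have pE' : horner_mx ad p = (ad - mu%:M) ^+ M * horner_mx ad q + c%:M.
  rewrite -[p](subrK c%:P) pE mulrC rmorphD rmorphM rmorphXn rmorphB /=.
  by rewrite horner_mx_X !horner_mx_C.
rewrite /horner_ad pE' mulmxDr -mulmxE mulmxA b0 mul0mx add0r mul_mx_scalar.
by rewrite linearZ /= mxvecK.
Qed.

Lemma horner_ad_trace_eq0 m (x y : 'I_m -> 'M[C]_n.+1) (q : {poly C}) :
  (forall k, \sum_i \tr (x i * iter k.+1 (fun b => b * z - z * b) (y i)) = 0) ->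
  \sum_i \tr (x i * horner_ad (q * 'X) (y i)) = 0.
Proof.
move=> xy0; rewrite /horner_ad.
have -> : horner_mx ad (q * 'X) = \sum_(k < size q) q`_k *: ad ^+ k.+1.
  rewrite -{1}(coefK q) poly_def mulr_suml rmorph_sum; apply: eq_bigr => k _.
  rewrite -scalerAl -exprSr -mul_polyC rmorphM rmorphXn /=.
  by rewrite horner_mx_X horner_mx_C -mul_scalar_mx.
under eq_bigr => i _.
  rewrite mulmx_sumr linear_sum mulr_sumr raddf_sum.
  under eq_bigr => k _.
    rewrite -scalemxAr mxvec_adX linearZ /= mxvecK -scalerAr mxtraceZ.
  over.
over.
rewrite exchange_big big1 // => k _.
by rewrite -mulr_sumr xy0 mulr0.
Qed.

End AdInterpolation.

(* With [E] the spectral projections of [z], the matrix [w = \sum_r r^* E_r]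
   satisfies [tr (z w) = \sum_r |r|^2 rank E_r], while [a w - w a] is a
   polynomial without constant term in [ad z], applied to [a]. *)
Lemma commutator_nilpotent (C : numClosedFieldType) n (z : 'M[C]_n.+1) m
    (x y : 'I_m -> 'M[C]_n.+1) :
  z = \sum_i (x i * y i - y i * x i) ->
  (forall k, \sum_i \tr (x i * iter k.+1 (fun b => b * z - z * b) (y i)) = 0) ->
  exists k, z ^+ k = 0.
Proof.
move=> zE xy0.
have [s [N [E [[us N0] E1 EE Ez zE0]]]] := spectral_projections z.
pose w := \sum_(r <- s) r^* *: E r.
have Ew r : r \in s -> E r * w = r^* *: E r.
  move=> rs; rewrite mulr_sumr (bigD1_seq r) //= -scalerAr EE // eqxx.
  rewrite big_seq_cond big1 ?addr0 // => t /andP [ts tr].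
  by rewrite -scalerAr EE // eq_sym (negPf tr) scaler0.
have wE r : r \in s -> w * E r = r^* *: E r.
  move=> rs; rewrite mulr_suml (bigD1_seq r) //= -scalerAl EE // eqxx.
  rewrite big_seq_cond big1 ?addr0 // => t /andP [ts tr].
  by rewrite -scalerAl EE // (negPf tr) scaler0.
have [Q QP] := chinese_interpolation [seq t - r | r <- s, t <- s] (N + N) Num.conj.
(* The difference r - r = 0 is a node with value 0, so [Q] has no constant term. *)
have [q Qq] : exists q, Q = q * 'X.
  have [r rs] : exists r, r \in s.
    case: (s) E1 => [|r l]; last by exists r; rewrite mem_head.
    by rewrite big_nil => /esym/eqP; rewrite oner_eq0.
  have /QP : 0 \in [seq t - r | r <- s, t <- s].
    by apply/allpairsP; exists (r, r); rewrite /= subrr.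
  rewrite conjC0 !subr0 -(prednK N0) addSn exprSr => /dvdpP [q ->].
  by exists (q * 'X ^+ (N.-1 + N.-1.+1)); rewrite mulrA.
(* Each block E_r a E_t is a generalised eigenvector of ad z for t - r. There [Q] acts by the
   conjugate of t - r, and so does a |-> a w - w a. *)
have adw a : horner_ad z Q a = a * w - w * a.
  have -> : a = \sum_(r <- s) \sum_(t <- s) E r * a * E t.
    under eq_bigr do rewrite -mulr_sumr E1 mulr1.
    by rewrite -mulr_suml E1 mul1r.
  rewrite horner_ad_sum mulr_suml mulr_sumr -sumrB.
  rewrite big_seq [RHS]big_seq; apply: eq_bigr => r rs.
  rewrite horner_ad_sum mulr_suml mulr_sumr -sumrB.
  rewrite big_seq [RHS]big_seq; apply: eq_bigr => t ts.
  rewrite (@horner_ad_eigen _ _ _ (t - r) ((t - r)^*) (N + N)).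
  - rewrite rmorphB scalerBl /=.
    by rewrite -[X in _ = X - _]mulrA Ew // !mulrA wE // -!scalerAr -!scalerAl.
  - by apply: QP; apply/allpairsP; exists (r, t).
  apply: ad_shift_nilpotent; first by rewrite !mulrA zE0 // !mul0r.
  suff Et0 : E t * (z - t%:M) ^+ N = 0 by rewrite -(mulrA (E r * a)) Et0 mulr0.
  rewrite -(zE0 t ts); apply: commrX; apply: commrB; first exact: Ez.
  exact: comm_mx_scalar.
(* By cyclicity tr ((x y - y x) w) = tr (x (y w - w y)), and the second factor is [Q] applied to
   y. *)
have trzw : \tr (z * w) = 0.
  rewrite {1}zE mulr_suml raddf_sum.
  transitivity (\sum_i \tr (x i * horner_ad z (q * 'X) (y i))); last first.
    exact: horner_ad_trace_eq0.
  apply: eq_bigr => i _; rewrite -Qq adw mulrBl mulrBr !raddfB /=.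
  congr (_ - _); first by rewrite mulrA.
  by rewrite -mulrA -mulmxE mxtrace_mulC mulmxE mulrA.
have trE r : r \in s -> \tr (E r) = (\rank (E r))%:R.
  by move=> rs; apply: mxtrace_idempotent; have := EE r r rs rs; rewrite eqxx.
have trzE r : r \in s -> \tr (z * E r) = r * \tr (E r).
  move=> rs; apply/eqP; rewrite -subr_eq0 -mxtraceZ -raddfB /=.
  have -> : z * E r - r *: E r = (z - r%:M) * E r.
    by rewrite mulrBl -[r%:M * _]/(r%:M *m _) mul_scalar_mx.
  rewrite (@mxtrace_nilpotent _ _ _ N) //.
  rewrite exprMn_comm; last first.
    by apply/commr_sym; apply: commrB; [exact: Ez|exact: comm_mx_scalar].
  by rewrite -(prednK N0) [E r ^+ _]exprS mulrA prednK // zE0 // mul0r.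
have {}trzw : \sum_(r <- s | r \in s) `|r| ^+ 2 * (\rank (E r))%:R = 0.
  rewrite -big_seq -[RHS]trzw mulr_sumr raddf_sum /= big_seq [RHS]big_seq.
  apply: eq_bigr => r rs; rewrite -scalerAr mxtraceZ trzE // trE //.
  by rewrite normCK mulrA [r * _]mulrC.
(* A vanishing sum of non-negative terms forces E_r = 0 for every r other than 0, and z^N kills
   E_0. *)
exists N; rewrite -[z ^+ N]mulr1 -E1 mulr_sumr big_seq big1 // => r rs.
have [r0|r0] := eqVneq r 0.
  by have := zE0 r rs; rewrite r0 raddf0 subr0.
move/eqP: trzw; rewrite psumr_eq0; last first.
  by move=> ? _; rewrite mulr_ge0 ?exprn_ge0 ?ler0n.
move=> /allP /(_ r rs); rewrite rs mulf_eq0 expf_eq0 normr_eq0 (negPf r0) /=.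
by rewrite pnatr_eq0 mxrank_eq0 => /eqP ->; rewrite mulr0.
Qed.



(** Scalars are extended to the algebraically closed field [R[i]]: the embedding preserves the trace
    conditions and reflects nilpotency. *)
Lemma commutator_nilpotent_real (R : rcfType) n (z : 'M[R]_n) m
    (x y : 'I_m -> 'M[R]_n) :
  z = \sum_i (x i * y i - y i * x i) ->
  (forall k, \sum_i \tr (x i * iter k.+1 (fun b => b * z - z * b) (y i)) = 0) ->
  exists k, z ^+ k = 0.
Proof.
case: n z x y => [|n] z x y zE xy0; first by exists 0%N; exact: flatmx0.
pose f : {rmorphism R -> R[i]} := real_complex R.
have [||k zk] := @commutator_nilpotent _ n (map_mx f z) m
  (fun i => map_mx f (x i)) (fun i => map_mx f (y i)).
- rewrite zE raddf_sum; apply: eq_bigr => i _.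
  by rewrite raddfB /= -!mulmxE !map_mxM.
- move=> k; rewrite -[RHS](rmorph0 f) -(xy0 k) raddf_sum; apply: eq_bigr => i _.
  have iterE b : map_mx f (iter k.+1 (fun b => b * z - z * b) b)
      = iter k.+1 (fun b => b * map_mx f z - map_mx f z * b) (map_mx f b).
    by elim: k.+1 => //= l <-; rewrite raddfB /= -!mulmxE !map_mxM.
  by rewrite -iterE -mulmxE -map_mxM trace_map_mx.
exists k; apply: (map_mx_inj (f := f)).
by rewrite rmorphXn /= zk map_mx0.
Qed.

(** * Ideals acting nilpotently *)

Section NilpotentAction.
Variables (K : fieldType) (L : lieAlgebra K).
Implicit Types (U V W H : {vspace L}) (I J P : ideal L) (x y z : L).

Lemma jacobi_ad x y z :
  [lie x, [lie y, z]] = [lie [lie x, y], z] + [lie y, [lie x, z]].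
Proof. by rewrite adjoint_bracket subrK. Qed.

Definition bracketv U W : {vspace L} :=
  setspan (fun z => exists u w : L, [/\ u \in U, w \in W & z = [lie u, w]]).

Lemma mem_bracketv U W x y : x \in U -> y \in W -> [lie x, y] \in bracketv U W.
Proof. by move=> xU yW; apply: mem_setspan; exists x, y. Qed.

Lemma bracketv_subvP U W V :
  (bracketv U W <= V)%VS <-> (forall x y, x \in U -> y \in W -> [lie x, y] \in V).
Proof.
split=> [/setspan_subvP UWV x y xU yW|UWV]; first by apply: UWV; exists x, y.
by apply/setspan_subvP => z [x [y [xU yW ->]]]; exact: UWV.
Qed.

Lemma bracketvS U U' W W' :
  (U <= U')%VS -> (W <= W')%VS -> (bracketv U W <= bracketv U' W')%VS.
Proof.
move=> /subvP UU' /subvP WW'; apply/bracketv_subvP => x y xU yW.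
by apply: mem_bracketv; [exact: UU'|exact: WW'].
Qed.

Lemma bracketv_sum U W z : z \in bracketv U W ->
  exists m (a b : 'I_m -> L),
    [/\ forall i, a i \in U, forall i, b i \in W & z = \sum_i [lie a i, b i]].
Proof.
rewrite /bracketv /setspan; case: cid => X [XP _] /= zX.
have /choice [ab abP] (i : 'I_(size X)) : exists p : L * L,
    [/\ p.1 \in U, p.2 \in W & X`_i = [lie p.1, p.2]].
  by have [u [w ?]] := XP _ (mem_nth 0 (ltn_ord i)); exists (u, w).
exists (size X), (fun i => coord (in_tuple X) i z *: (ab i).1), (fun i => (ab i).2).
split=> [i|i|]; try by have [? ? _] := abP i; rewrite ?rpredZ.
rewrite [LHS](@coord_span _ _ _ (in_tuple X)) //; apply: eq_bigr => i _.
by rewrite linearZl; have [_ _ ->] := abP i.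
Qed.

Lemma bracketv_ideal I J : (bracketv I J <= J)%VS.
Proof. by apply/bracketv_subvP => x y _; exact: ideal_stable. Qed.

Lemma bracketI_stable I J x y : y \in bracketv I J -> [lie x, y] \in bracketv I J.
Proof.
move=> /bracketv_sum [m [a [b [aI bJ ->]]]]; rewrite linear_sumr.
apply: rpred_sum => i _; rewrite jacobi_ad rpredD //.
  by apply: mem_bracketv => //; exact: ideal_stable.
by apply: mem_bracketv => //; exact: ideal_stable.
Qed.

Definition bracketI I J : ideal L := @Submodule K L (adjoint L) _ (@bracketI_stable I J).

Fixpoint ad_series U k : {vspace L} :=
  if k is j.+1 then bracketv U (ad_series U j) else fullv.

(** A uniform condition: all products of [k] maps ad u with u in [U] vanish, which is more than
    nilpotency of each ad u. *)
Definition nilact U := exists k, ad_series U k = 0%VS.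

Fixpoint ad_seriesI P k : ideal L :=
  if k is j.+1 then bracketI P (ad_seriesI P j) else submodulef (adjoint L).

Lemma ad_seriesIE P k : ad_seriesI P k = ad_series P k :> {vspace L}.
Proof. by elim: k => //= k ->. Qed.

Lemma ad_seriesS U W k : (U <= W)%VS -> (ad_series U k <= ad_series W k)%VS.
Proof. by move=> UW; elim: k => //= k; exact: bracketvS. Qed.

Lemma ad_series_decr U k : (ad_series U k.+1 <= ad_series U k)%VS.
Proof. by elim: k => [|k IH]; [exact: subvf|exact: bracketvS]. Qed.

Lemma nilactS U W : (U <= W)%VS -> nilact W -> nilact U.
Proof.
move=> UW [k Wk0]; exists k; apply/eqP.
by rewrite -subv0 -Wk0 ad_seriesS.
Qed.

(* The chain form of [nilact] on a subspace; it lets a chain be refined without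
   index arithmetic. *)
Inductive nil_on U : {vspace L} -> Prop :=
| nil_on0 : nil_on U 0%VS
| nil_onS W V : (bracketv U W <= V)%VS -> nil_on U V -> nil_on U W.

Lemma nil_on_sub U V W : nil_on U V -> (W <= V)%VS -> nil_on U W.
Proof.
move=> nV; elim: nV W => [|W' V' W'V' nV' IH] W WV.
  by move: WV; rewrite subv0 => /eqP ->; exact: nil_on0.
by apply: (nil_onS _ nV'); exact: subv_trans (bracketvS (subvv _) WV) W'V'.
Qed.

Lemma nilact_on U : nil_on U fullv -> nilact U.
Proof.
suff key W j : nil_on U W -> (ad_series U j <= W)%VS -> nilact U.
  by move=> /key; apply; exact: (subvv (ad_series U 0)).
move=> nW; elim: nW j => [|{}W V WV _ IH] j jW.
  by exists j; apply/eqP; rewrite -subv0.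
by apply: (IH j.+1) => /=; exact: subv_trans (bracketvS (subvv _) jW) WV.
Qed.

(* If [P^n B <= A], then [W := [P, B] + A] has a complement [W'] relative to [A]
   in [B], and [P, W'] <= A, so [W = [P, W] + A = ... = A]. *)
Lemma nilact_complemented P (A B : ideal L) : nilact P -> (A <= B)%VS ->
  complemented (M := adjoint L) A B -> (bracketv P B <= A)%VS.
Proof.
move=> [n Pn0] AB cAB.
pose W := submoduleD (bracketI P B) A.
have BW : (W <= B)%VS.
  rewrite subv_add AB andbT; apply/bracketv_subvP => x y _ yB; exact: ideal_stable.
have [|W' [AW' W'B WW'B WW'A]] := cAB W _ BW; first exact: addvSr.
have PW' : (bracketv P W' <= A)%VS.
  rewrite -WW'A subv_cap; apply/andP; split; last first.
    by apply/bracketv_subvP => x y _ yW'; exact: ideal_stable.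
  by apply: subv_trans (addvSl _ _); exact: bracketvS.
suff WF k : (W <= ad_series P k + A)%VS.
  by have := WF n; rewrite Pn0 add0v; apply: subv_trans; exact: addvSl.
elim: k => [|k IH] /=; first by rewrite (subv_trans (subvf _)) // addvSl.
rewrite subv_add addvSr andbT; apply/bracketv_subvP => x y xP; rewrite -WW'B.
move=> /memv_addP [w wW [w' w'W' ->]]; rewrite linearDr rpredD //; last first.
  by apply: (subvP (addvSr _ _)); apply: (subvP PW'); exact: mem_bracketv.
have /memv_addP [u uk [a aA ->]] := subvP IH _ wW.
by rewrite linearDr memv_add ?mem_bracketv // ideal_stable.
Qed.

Definition subalgebra H := (bracketv H H <= H)%VS.

(** As [x] normalises [H], it preserves every term F_j of the series of [H]. Between F_(j+1) and F_j
    the chain is refined by the spaces F_(j+1) + (ad x)^i F_j: there [H] maps into F_(j+1) and [x]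
    raises the exponent. *)
Lemma nilact_ext H x : subalgebra H -> nilact H ->
  (forall h, h \in H -> [lie x, h] \in H) ->
  (exists k, forall y, iter k (bracket x) y = 0) ->
  nilact (H + <[x]>).
Proof.
move=> Hs [n Hn0] xH [m xm0]; apply: nilact_on.
have xF j y : y \in ad_series H j -> [lie x, y] \in ad_series H j.
  elim: j y => [|j IH] y /=; first by rewrite !memvf.
  move=> /bracketv_sum [l [a [b [aH bj ->]]]]; rewrite linear_sumr rpred_sum // => i _.
  by rewrite jacobi_ad rpredD // mem_bracketv ?xH // IH.
have xiF j k y : y \in ad_series H j -> iter k (bracket x) y \in ad_series H j.
  by move=> yF; elim: k => //= k; exact: xF.
have F0 : nil_on (H + <[x]>) (ad_series H n) by rewrite Hn0; exact: nil_on0.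
suff key j : nil_on (H + <[x]>) (ad_series H j.+1) -> nil_on (H + <[x]>) (ad_series H j).
  have nk k : (k <= n)%N -> nil_on (H + <[x]>) (ad_series H (n - k)).
    elim: k => [|k IH] kn; first by rewrite subn0.
    by apply: key; rewrite subnSK //; apply: IH; exact: ltnW.
  by have := nk n (leqnn n); rewrite subnn.
move=> nS; pose adk k : 'End(L) := iter k (comp_lfun (linfun (bracket x))) \1%VF.
have adkE k y : adk k y = iter k (bracket x) y.
  by elim: k => [|k IH]; rewrite /= ?id_lfunE // comp_lfunE IH lfunE.
suff G k : nil_on (H + <[x]>) (ad_series H j.+1 + adk (m - k)%N @: ad_series H j)%VS.
  apply: (nil_on_sub (G m)); apply: subv_trans (addvSr _ _).
  rewrite subnn; apply/subvP => y yj; rewrite -[y]/(iter 0 (bracket x) y) -adkE.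
  exact: memv_img.
elim: k => [|k IH].
  rewrite subn0; suff -> : (adk m @: ad_series H j = 0)%VS by rewrite addv0.
  apply/eqP; rewrite -subv0; apply/subvP => _ /memv_imgP [y _ ->].
  by rewrite adkE xm0 mem0v.
have [mk|km] := leqP m k.
  by apply: nil_on_sub IH _; have /eqP -> := mk; have /eqP -> := leqW mk.
apply: nil_onS IH; apply/bracketv_subvP => h y /memv_addP [h1 h1H [c /vlineP [a ->] ->]].
move=> /memv_addP [y1 y1F [_ /memv_imgP [y2 y2F ->] ->]].
rewrite adkE linearDl linearDr /=; apply: rpredD.
  apply: (subvP (addvSl _ _)); rewrite -linearDr; apply: mem_bracketv => //.
  by rewrite rpredD ?xiF // (subvP (ad_series_decr _ _)).
rewrite linearZl_LR rpredZ // linearDr memv_add //; first exact: (xF j.+1).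
by apply/memv_imgP; exists y2; rewrite ?adkE // -(subnSK km).
Qed.

Lemma exists_maxdimv (Q : {vspace L} -> Prop) U0 : Q U0 ->
  exists2 U, Q U & forall W, Q W -> (\dim W <= \dim U)%N.
Proof.
move=> QU0; pose D n := `[< exists2 U, Q U & \dim U = n >].
have D0 : exists n, D n by exists (\dim U0); apply/asboolP; exists U0.
have Dmax n : D n -> (n <= \dim {:L})%N.
  by move=> /asboolP [U _ <-]; rewrite dimvS // subvf.
have [n /asboolP [U QU <-] nmax] := ex_maxnP D0 Dmax.
by exists U => // W QW; apply: nmax; apply/asboolP; exists W.
Qed.

(* Engel's theorem: a maximal nilpotently acting subalgebra of [P] is all of
   [P], since otherwise it can be enlarged by an element normalising it. *)
Lemma nilact_ad_nilpotent P :
  (forall x, x \in (P : {vspace L}) -> exists k, forall y, iter k (bracket x) y = 0) ->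
  nilact P.
Proof.
move=> adP.
have Q0 : [/\ subalgebra 0, nilact 0 & (0 <= P)%VS].
  split; last exact: sub0v.
    apply/bracketv_subvP => x y; rewrite !memv0 => /eqP -> _.
    by rewrite linear0l.
  exists 1%N; apply/eqP; rewrite -subv0; apply/bracketv_subvP => x y.
  by rewrite memv0 => /eqP -> _; rewrite linear0l memv0.
have [H [Hs Hn HP] Hmax] := @exists_maxdimv
  (fun H => [/\ subalgebra H, nilact H & (H <= P)%VS]) _ Q0.
suff PH : (P <= H)%VS by exact: nilactS PH Hn.
apply: contrapT => /negP PH.
have [x [xP xH Hx]] : exists x, [/\ x \in (P : {vspace L}), x \notin H &
    forall h, h \in H -> [lie h, x] \in H].
  have [n Hn0] := Hn.
  (* For the least such index, which is positive, any element of [P] in the preceding term and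
     outside [H] is bracketed by [H] into [P :&: ad_series H k], hence into [H]. *)
  have ex : exists k, (P :&: ad_series H k <= H)%VS.
    by exists n; rewrite Hn0 capv0 sub0v.
  case: (ex_minnP ex) => [[|k]] kH kmin.
    by move: kH PH; rewrite capvf => ->.
  have /subvPn [x] : ~~ (P :&: ad_series H k <= H)%VS.
    by apply/negP => /kmin; rewrite ltnn.
  rewrite memv_cap => /andP [xP xk] xH; exists x; split=> // h hH.
  apply: (subvP kH); rewrite memv_cap ideal_stable //=.
  exact: mem_bracketv.
have /Hmax : [/\ subalgebra (H + <[x]>), nilact (H + <[x]>) & (H + <[x]> <= P)%VS].
  split.
  - rewrite /subalgebra; apply/bracketv_subvP => u v.
    move=> /memv_addP [h hH [_ /vlineP [a ->] ->]].
    move=> /memv_addP [h' h'H [_ /vlineP [b ->] ->]].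
    apply: (subvP (addvSl _ _)).
    rewrite linearDl !linearDr /= !linearZl_LR !linearZr_LR /= bracketxx !scaler0 addr0.
    rewrite (bracketC x) !rpredD ?rpredZ ?rpredN ?Hx //.
    by apply: (subvP Hs); exact: mem_bracketv.
  - apply: nilact_ext => //; last exact: adP.
    by move=> h hH; rewrite bracketC rpredN Hx.
  by rewrite subv_add HP -memvE.
move=> le; case/negP: xH; rewrite memvE.
have /eqP -> : (H == H + <[x]>)%VS by rewrite eqEdim addvSl.
exact: addvSr.
Qed.

End NilpotentAction.

(** * The Killing form *)

Section Killing.
Variables (K : fieldType) (L : lieAlgebra K).
Implicit Types (U V W H : {vspace L}) (I J P : ideal L) (x y z : L).

Local Notation e := (vbasis {:L}).

Definition admx x : 'M[K]_(\dim {:L}) := mxof e e (linfun (bracket x)).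

Let eb : basis_of {:L} e := vbasisP _.

Lemma admx_is_linear : linear admx.
Proof.
move=> a x y; rewrite /admx -linearP /=; congr (mxof _ _ _).
by apply/lfunP => v; rewrite add_lfunE scale_lfunE !lfunE /= linearPl.
Qed.

HB.instance Definition _ := GRing.isLinear.Build K L _ _ admx admx_is_linear.

Lemma admx_app x y : rVof e [lie x, y] = rVof e y *m admx x.
Proof. by rewrite -(rVof_app _ eb) lfunE. Qed.

Lemma rVof_inj x y : rVof e x = rVof e y -> x = y.
Proof. by move=> xy; rewrite -(rVofK eb x) xy rVofK. Qed.

Lemma admx_app_inj (A B : 'M[K]_(\dim {:L})) :
  (forall x, rVof e x *m A = rVof e x *m B) -> A = B.
Proof.
move=> AB; apply/row_matrixP => i; rewrite !rowE.
by rewrite -(vecofK eb (delta_mx 0 i)) AB.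
Qed.

(** Matrices act on row vectors from the right, so the order of composition is reversed. *)
Lemma admx_bracket x y : admx [lie x, y] = admx y *m admx x - admx x *m admx y.
Proof.
apply: admx_app_inj => v; rewrite mulmxBr !mulmxA -!admx_app -linearB.
by rewrite adjoint_bracket.
Qed.

Lemma admx_iter x k y : rVof e (iter k (bracket x) y) = rVof e y *m admx x ^+ k.
Proof.
elim: k => [|k IH]; first by rewrite expr0 mulmx1.
by rewrite /= admx_app IH exprSr -mulmxE mulmxA.
Qed.

Lemma admx_nilpotentP x k :
  (forall y, iter k (bracket x) y = 0) <-> admx x ^+ k = 0.
Proof.
split=> [x0|x0 y]; last by apply: rVof_inj; rewrite admx_iter x0 mulmx0 linear0.
by apply: admx_app_inj => y; rewrite -admx_iter x0 linear0 mulmx0.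
Qed.

Definition killing x y : K := \tr (admx x *m admx y).

Lemma killing_bilinear : bilinear_for
  (GRing.Scale.Law.clone _ _ *%R _) (GRing.Scale.Law.clone _ _ (idfun \; *%R) _)
  killing.
Proof.
split=> [u|x] a y z; rewrite /killing !linearP //=.
by rewrite mulmxDl -scalemxAl mxtraceD mxtraceZ.
Qed.

HB.instance Definition _ :=
  bilinear_isBilinear.Build K L L K _ _ killing killing_bilinear.

Lemma killing_sym x y : killing x y = (-1) ^+ false * idfun (killing y x).
Proof. by rewrite /killing expr0 mul1r mxtrace_mulC. Qed.

HB.instance Definition _ :=
  isHermitianSesquilinear.Build K L false idfun killing killing_sym.

Lemma killingC x y : killing x y = killing y x.
Proof. by rewrite killing_sym expr0 mul1r. Qed.

Lemma killing_invariant x y z : killing [lie x, y] z = killing x [lie y, z].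
Proof.
rewrite /killing !admx_bracket mulmxBl mulmxBr !raddfB /= !mulmxA.
by rewrite -(mulmxA (admx y)) mxtrace_mulC.
Qed.

Definition kperp U : {vspace L} := orthov killing U.

Lemma mem_kperp U x : x \in kperp U <-> (forall y, y \in U -> killing x y = 0).
Proof. by split=> [/mem_orthovP xU y /xU //|xU]; apply/mem_orthovP. Qed.

Lemma killing_kperp U x y : x \in kperp U -> y \in U -> killing x y = 0.
Proof. by move=> /mem_kperp xU /xU. Qed.

Lemma kperp_stable I x y : y \in kperp I -> [lie x, y] \in kperp I.
Proof.
move=> /mem_kperp yI; apply/mem_kperp => z zI.
by rewrite bracketC linearNl /= killing_invariant yI ?oppr0 // ideal_stable.
Qed.

Definition kperpI I : ideal L := @Submodule K L (adjoint L) _ (@kperp_stable I).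

Lemma kperpS U W : (U <= W)%VS -> (kperp W <= kperp U)%VS.
Proof.
move=> /subvP UW; apply/subvP => x /mem_kperp xW; apply/mem_kperp => y /UW.
exact: xW.
Qed.

Definition krad : {vspace L} := kperp fullv.

(* For [x] in [P], [ad x ad y] maps each term of the lower series to the next. *)
Lemma nilact_krad P : nilact P -> (P <= krad)%VS.
Proof.
move=> [n Pn0]; apply/subvP => x xP; apply/mem_kperp => y _.
rewrite killingC; apply: (@mxtrace_nilpotent _ _ _ n).
apply: admx_app_inj => v; rewrite mulmx0.
suff [w wn ->] : exists2 w, w \in ad_series P n &
    rVof e v *m (admx y *m admx x) ^+ n = rVof e w.
  by move: wn; rewrite Pn0 memv0 => /eqP ->; rewrite linear0.
elim: (n) => [|k [w wk IH]]; first by exists v; rewrite ?memvf // expr0 mulmx1.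
exists [lie x, [lie y, w]].
  apply: (@mem_bracketv _ _ P (ad_series P k)) => //.
  by rewrite -ad_seriesIE ideal_stable // ad_seriesIE.
by rewrite exprSr -mulmxE !mulmxA IH -!admx_app.
Qed.

(** A dimension count for a possibly degenerate form. The part of [U] in [krad] imposes no condition
    on [kperp U], so the codimension of [kperp U] is at most the dimension of a complement [U0] of
    that part. The hypothesis bounds the overlap of [U] and [kperp U] by the same part. *)
Lemma addv_kperp U : (U :&: kperp U <= krad)%VS -> (U + kperp U = fullv)%VS.
Proof.
move=> UUr; pose U0 := (U :\: krad)%VS.
have UE : (U :&: krad + U0 = U)%VS by rewrite addvC; exact: addv_diff_cap.
have U0p : (kperp U0 <= kperp U)%VS.
  apply/subvP => x /mem_kperp xU0; apply/mem_kperp => y; rewrite -UE.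
  move=> /memv_addP [a /memv_capP [_ /mem_kperp ar] [b bU0 ->]].
  by rewrite linearDr /= killingC ar ?memvf // add0r xU0.
apply/eqP; rewrite eqEdim subvf /=.
rewrite -(leq_add2r (\dim (U :&: kperp U))) dimv_sum_cap.
have := dim_cap_orthov killing U0 fullv; rewrite capfv => le.
have UUle : (\dim (U :&: kperp U) <= \dim (U :&: krad))%N.
  by rewrite dimvS // subv_cap capvSl.
apply: leq_trans (leq_add le UUle) _.
rewrite -addnA [(\dim U0 + _)%N]addnC dimv_cap_compl addnC leq_add2l.
exact: dimvS.
Qed.

Lemma mem_kradP x : x \in krad -> forall y, killing x y = 0.
Proof. by move=> /mem_kperp xr y; rewrite xr ?memvf. Qed.

Lemma krad_kperp U : (krad <= kperp U)%VS.
Proof. exact/kperpS/subvf. Qed.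

End Killing.

(** * Cartan's criterion and semisimple quotients of the adjoint module *)

Section KillingRadical.
Variables (R : rcfType) (L : lieAlgebra R).
Implicit Types (I J P A B C D : ideal L) (x y z : L).

Lemma ad_nilpotent_sum m (a b : 'I_m -> L) :
  let z := \sum_i [lie a i, b i] in
  (forall i k, killing (a i) (iter k.+1 (bracket z) (b i)) = 0) ->
  exists k, forall y, iter k (bracket z) y = 0.
Proof.
move=> z ab0.
(* The sign compensates for the reversed order in [admx_bracket]. *)
have [||k zk] := @commutator_nilpotent_real R _ (admx z) m
    (fun i => - admx (a i)) (fun i => admx (b i)).
- rewrite /z linear_sum; apply: eq_bigr => i _ /=.
  by rewrite admx_bracket mulNr mulrN opprK addrC.
- move=> k; apply: big1 => i _.
  have -> : iter k.+1 (fun c => c * admx z - admx z * c) (admx (b i))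
      = admx (iter k.+1 (bracket z) (b i)).
    by elim: k.+1 => //= j ->; rewrite admx_bracket.
  by rewrite mulNr raddfN /= -[\tr _]/(killing _ _) ab0 oppr0.
by exists k; apply/admx_nilpotentP.
Qed.

(* If [z = sum_i [a_i, b_i]] is in [P], then the [(ad z)^(k+1) b_i] are in [C],
   which is orthogonal to the [a_i]. *)
Lemma nilact_bracketv P A B C : (P <= bracketv A B)%VS -> (bracketv P B <= C)%VS ->
  (bracketv P C <= C)%VS -> (A <= kperp C)%VS -> nilact P.
Proof.
move=> PAB PBC PCC AC; apply: nilact_ad_nilpotent => z zP.
have [m [a [b [aA bB zE]]]] := bracketv_sum (subvP PAB _ zP).
rewrite zE; apply: ad_nilpotent_sum; rewrite -zE => i k.
apply: (killing_kperp (U := C)); first exact: (subvP AC).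
elim: k => [|k IH]; first by apply: (subvP PBC); exact: mem_bracketv.
by rewrite iterS; apply: (subvP PCC); exact: mem_bracketv.
Qed.

Let T : ideal L := submodulef (adjoint L).

(* Cartan's criterion, obtained by applying [nilact_bracketv] to [[A, A]], then to
   [[L, A]], then to [A]: each step puts an ideal into the Killing radical, where
   the next one needs it. *)
Lemma kisotropic_bracketv_nilact A : (A <= kperp A)%VS -> nilact (bracketI T A).
Proof.
move=> AA; have nAA : nilact (bracketI A A).
  apply: (@nilact_bracketv (bracketI A A) A A A) => //=;
    exact: (bracketv_ideal (bracketI A A)).
apply: (@nilact_bracketv (bracketI T A) T A (bracketI A A)) => //=.
- by apply: bracketvS => //; exact: (bracketv_ideal T A).
- exact: (bracketv_ideal (bracketI T A) (bracketI A A)).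
apply/subvP => x _; apply/mem_kperp => y yAA.
by rewrite killingC (mem_kradP (subvP (nilact_krad nAA) _ yAA)).
Qed.

Lemma kisotropic_derived_nilact A : (A <= kperp A)%VS -> (A <= bracketv T T)%VS ->
  nilact A.
Proof.
move=> AA AT; have nTA := kisotropic_bracketv_nilact AA.
apply: (@nilact_bracketv A T T (bracketI T A)) => //=.
- apply/bracketv_subvP => x y xA yT; rewrite bracketC rpredN; exact: mem_bracketv.
- exact: (bracketv_ideal A (bracketI T A)).
apply/subvP => x _; apply/mem_kperp => y yTA.
by rewrite killingC (mem_kradP (subvP (nilact_krad nTA) _ yTA)).
Qed.

Let D : ideal L := bracketI T T.

Lemma derived_kperp_nilact : nilact (submoduleI D (kperpI D)).
Proof.
apply: kisotropic_derived_nilact; rewrite /= ?capvSl //.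
by apply: subv_trans (capvSr _ _) _; apply: kperpS; exact: capvSl.
Qed.

Lemma addv_derived_kperp : (D + kperp D = fullv)%VS.
Proof. exact/addv_kperp/(nilact_krad derived_kperp_nilact). Qed.

(** Every subspace containing [D] is an ideal, so a linear complement suffices. *)
Lemma complemented_derived : complemented (M := adjoint L) D T.
Proof.
move=> I DI _.
have Cs x y : y \in (D + I^C)%VS -> [lie x, y] \in (D + I^C)%VS.
  by move=> _; apply: (subvP (addvSl _ _)); apply: mem_bracketv; exact: memvf.
exists (@Submodule _ _ (adjoint L) _ Cs); split=> /=.
- exact: addvSl.
- exact: subvf.
- by rewrite addvA (addv_idPl DI) addv_complf.
by rewrite capvC -vspace_modl // capvC capv_compl addv0.
Qed.

(** For an ideal [I] containing D^perp (for the Killing form), put A = I :&: I^perp. It is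
    orthogonal to D^perp, and to [D] by invariance, since [L, A] acts nilpotently and so lies in the
    Killing radical. As D + D^perp is everything, [A] lies in that radical too. Hence I + I^perp is
    everything, and D^perp + I^perp is the complement. *)
Lemma complemented_kperp_derived : complemented (M := adjoint L) (kperpI D) T.
Proof.
move=> I kDI _.
pose A := submoduleI I (kperpI I).
have AA : (A <= kperp A)%VS.
  by apply: subv_trans (capvSr _ _) _; apply: kperpS; exact: capvSl.
have AD : (A <= kperp D)%VS.
  apply/subvP => x xA; apply/mem_kperp => y /bracketv_sum [m [a [b [_ _ ->]]]].
  rewrite linear_sumr big1 // => i _ /=; rewrite -killing_invariant.
  apply: mem_kradP; apply: (subvP (nilact_krad (kisotropic_bracketv_nilact AA))).
  by rewrite /= bracketC rpredN mem_bracketv ?memvf.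
have Ar : (A <= krad L)%VS.
  apply/subvP => x xA; apply/mem_kperp => y _.
  have : y \in (D + kperp D)%VS by rewrite addv_derived_kperp memvf.
  move=> /memv_addP [u uD [v vD ->]].
  have xI : x \in kperp I by case/memv_capP: xA.
  rewrite linearDr /= (killing_kperp (subvP AD _ xA)) // add0r.
  exact: killing_kperp xI (subvP kDI _ vD).
exists (submoduleD (kperpI D) (kperpI I)); split=> /=.
- exact: addvSl.
- exact: subvf.
- apply/eqP; rewrite eqEsubv subvf.
  by rewrite -(addv_kperp (Ar : (I :&: kperp I <= _)%VS)) addvS ?addvSr.
rewrite capvC -vspace_modl // capvC; apply/addv_idPl.
by rewrite (subv_trans Ar) ?krad_kperp.
Qed.

End KillingRadical.

(** * Socle and radical series *)

Section LfunLattice.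
Variables (K : fieldType) (U V : vectType K) (f : 'Hom(U, V)).
Implicit Types (A B : {vspace U}).

Lemma lpreim_limg A : (lker f <= A)%VS -> (f @^-1: (f @: A) = A)%VS.
Proof.
move=> kA; apply/vspaceP => v; rewrite -memv_preim.
apply/idP/idP => [/memv_imgP [w wA /eqP]|]; last exact: memv_img.
rewrite -subr_eq0 -linearB -memv_ker => /(subvP kA) vw.
by rewrite -[v](subrK w) memvD.
Qed.

Lemma limg_capr A B : (lker f <= B)%VS -> (f @: (A :&: B) = f @: A :&: f @: B)%VS.
Proof.
move=> kB; apply/eqP; rewrite eqEsubv limg_cap /=; apply/subvP => v.
rewrite memv_cap => /andP [/memv_imgP [a aA ->] fB].
by rewrite memv_img // memv_cap aA -(lpreim_limg kB) -memv_preim.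
Qed.

Lemma lpreimI (A B : {vspace V}) : (f @^-1: (A :&: B) = f @^-1: A :&: f @^-1: B)%VS.
Proof. by apply/vspaceP => v; rewrite -memv_preim !memv_cap -!memv_preim. Qed.

Lemma lker_lpreim (A : {vspace V}) : (lker f <= f @^-1: A)%VS.
Proof. by rewrite -lpreim0 lpreimS // sub0v. Qed.

End LfunLattice.

Section Complemented.
Variables (K : fieldType) (L : lieAlgebra K).

(** Submodules with the same underlying space may differ as records, so complements are transported
    along equality of spaces. *)
Lemma complemented_eq (M : lieModule L) (A B A' B' : submodule M) :
  complemented A B -> (A = A' :> {vspace M}) -> (B = B' :> {vspace M}) ->
  complemented A' B'.
Proof. by rewrite /complemented => + <- <-. Qed.

Variables (M N : lieModule L) (f : 'Hom(M, N)).
Hypothesis fM : forall x v, f (action x v) = action x (f v).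

Lemma complemented_image (A B : submodule M) : (A <= B)%VS -> (lker f <= A)%VS ->
  complemented A B ->
  complemented (submodule_image fM A) (submodule_image fM B).
Proof.
move=> AB kA cAB W /= AW WB.
have fV : (f @: (f @^-1: W :&: B) = W)%VS.
  apply/vspaceP => w; apply/memv_imgP/idP => [[v + ->]|wW].
    by rewrite memv_cap -memv_preim => /andP [].
  have /memv_imgP [v vB wE] := subvP WB _ wW.
  by exists v; rewrite // memv_cap -memv_preim -wE wW.
have [|| V' [AV' V'B VV'B VV'A]] := cAB (submoduleI (submodule_preim fM W) B).
- by rewrite /= subv_cap AB andbT -(lpreim_limg kA) lpreimS.
- exact: capvSr.
have kV' : (lker f <= V')%VS by exact: subv_trans kA AV'.
exists (submodule_image fM V'); split=> /=; try exact: limgS.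
  by rewrite -[in LHS]fV -limgD; congr (f @: _)%VS; exact: VV'B.
by rewrite -[in LHS]fV -limg_capr //; congr (f @: _)%VS; exact: VV'A.
Qed.

Lemma complemented_preim (A B : submodule N) : (A <= B)%VS -> (B <= limg f)%VS ->
  complemented A B ->
  complemented (submodule_preim fM A) (submodule_preim fM B).
Proof.
move=> AB Bf cAB W /= AW WB.
have kW : (lker f <= W)%VS by exact: subv_trans (lker_lpreim _ _) AW.
have [|| W' [AW' W'B WW'B WW'A]] := cAB (submodule_image fM W) => /=.
- by rewrite -(@lpreimK _ _ _ f A) ?limgS // (subv_trans AB).
- by rewrite -(@lpreimK _ _ _ f B) ?limgS.
exists (submodule_preim fM W'); split=> /=.
- exact: lpreimS.
- exact: lpreimS.
- rewrite -[LHS](@lpreim_limg _ _ _ f); last exact: subv_trans kW (addvSl _ _).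
  by rewrite limgD lpreimK ?WW'B // (subv_trans W'B).
by rewrite -{1}(lpreim_limg kW) -lpreimI WW'A.
Qed.

End Complemented.

Section Series.
Variables (K : fieldType) (L : lieAlgebra K) (M : lieModule L).
Local Notation Rs := (radical_series M).
Local Notation Ss := (socle_series M).


Lemma radical_seriesS k : (Rs k.+1 <= Rs k)%VS.
Proof.
by apply: subv_trans (limgS _ (subvf _)) _; rewrite limg_sub_incl.
Qed.

(** Together with [radical_series_min] this describes the series inside the lattice of submodules of
    [M], without subquotients. *)
Lemma radical_series_complemented k : complemented (Rs k.+1) (Rs k).
Proof.
have [/semisimple_quotP cR _] := radicalP (sub_module (Rs k)).
apply: complemented_eq
  (complemented_image (fM := @sub_inclM _ _ _ (Rs k)) _ _ cR) _ _ => //.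
- exact: subvf.
- by rewrite lker_sub_incl sub0v.
by rewrite /= limg_sub_incl.
Qed.

Lemma radical_series_min k (U : submodule M) : (U <= Rs k)%VS ->
  complemented U (Rs k) -> (Rs k.+1 <= U)%VS.
Proof.
move=> UR cU; have [_ Rmin] := radicalP (sub_module (Rs k)).
have f1U : (sub_incl (Rs k) @: (sub_incl (Rs k) @^-1: U) = U)%VS.
  by rewrite lpreimK // limg_sub_incl.
suff /Rmin RU : semisimple (quot_module
    (submodule_preim (@sub_inclM _ _ _ (Rs k)) U)).
  by rewrite -[X in (_ <= X)%VS]f1U; exact: limgS.
apply/semisimple_quotP; apply: complemented_eq
  (complemented_preim (fM := @sub_inclM _ _ _ (Rs k)) UR _ cU) _ _ => //=.
  by rewrite limg_sub_incl.
by apply/vspaceP => u; rewrite -memv_preim memvf lfunE /= subvsP.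
Qed.

Lemma socle_seriesS k : (Ss k <= Ss k.+1)%VS.
Proof. by rewrite -[X in (X <= _)%VS]lker_quotp lker_lpreim. Qed.

Lemma socle_series_complemented k : complemented (Ss k) (Ss k.+1).
Proof.
have [/semisimple_subP cS _] := socleP (quot_module (Ss k)).
apply: complemented_eq
  (complemented_preim (fM := @quot_projM _ _ _ (Ss k)) _ _ cS) _ _ => //.
- exact: sub0v.
- by rewrite limg_quotp subvf.
by rewrite /= lpreim0 lker_quotp.
Qed.

Lemma socle_series_max k (U : submodule M) : (Ss k <= U)%VS ->
  complemented (Ss k) U -> (U <= Ss k.+1)%VS.
Proof.
move=> SU cU; have [_ Smax] := socleP (quot_module (Ss k)).
have q1U : (quot_proj (Ss k) @^-1: (quot_proj (Ss k) @: U) = U)%VS.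
  by rewrite lpreim_limg // lker_quotp.
suff /Smax US : semisimple (sub_module
    (submodule_image (@quot_projM _ _ _ (Ss k)) U)).
  by rewrite -q1U; exact: lpreimS.
apply/semisimple_subP; apply: complemented_eq
  (complemented_image (fM := @quot_projM _ _ _ (Ss k)) SU _ cU) _ _ => //=.
  by rewrite lker_quotp.
by apply/eqP; rewrite -lkerE lker_quotp.
Qed.

(** A non-zero R_k has a maximal proper submodule [U]. The quotient by [U] is simple, so R_(k+1) <=
    U, a proper submodule. *)
Lemma radical_series_stab k :
  (Rs k <= Rs k.+1)%VS -> Rs k = 0%VS :> {vspace M}.
Proof.
move=> RR; apply: contrapT => R0.
have P0 : (submodule0 M <= Rs k)%VS /\ (submodule0 M <> Rs k :> {vspace M}).
  by split=> [|/esym //]; exact: sub0v.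
have [U [UR UneR] Umax] := @exists_maxdim _ _ _
  (fun U => (U <= Rs k)%VS /\ (U <> Rs k :> {vspace M})) _ P0.
suff RU : (Rs k <= U)%VS by apply: UneR; apply/eqP; rewrite eqEsubv UR RU.
apply: subv_trans RR _; apply: radical_series_min => // W UW WR.
have [WE|WneR] := pselect (W = Rs k :> {vspace M}).
  by exists U; split=> //; rewrite WE; [exact/addv_idPl|exact/capv_idPr].
have WU : W = U :> {vspace M}.
  by apply/esym/eqP; rewrite eqEdim UW Umax.
exists (Rs k); split=> //; first by rewrite WU; exact/addv_idPr.
by rewrite WU; exact/capv_idPl.
Qed.

Lemma radical_series_eventually0 : exists k, Rs k = 0%VS :> {vspace M}.
Proof.
apply: contrapT => R0.
have dR k : (\dim (Rs k) + k <= \dim {:M})%N.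
  elim: k => [|k IH]; first by rewrite addn0.
  apply: leq_trans IH; rewrite addnS -addSn leq_add2r ltnNge; apply/negP => le.
  apply: R0; exists k; apply: radical_series_stab.
  have /eqP <- : (Rs k.+1 == Rs k :> {vspace M})%VS by rewrite eqEdim radical_seriesS.
  by [].
by have := dR (\dim {:M}).+1; rewrite addnS ltnNge leq_addl.
Qed.

End Series.

Section RadicalNilpotent.
Variables (R : rcfType) (L : lieAlgebra R).
Local Notation T := (submodulef (adjoint L)).

Lemma radical_series1_nilact : nilact (radical_series (adjoint L) 1 : {vspace L}).
Proof.
apply: nilactS (derived_kperp_nilact L); rewrite /= subv_cap; apply/andP; split.
  apply: (@radical_series_min _ _ (adjoint L) 0 (bracketI T T)); first exact: subvf.
  exact: complemented_derived.
apply: (@radical_series_min _ _ (adjoint L) 0 (kperpI (bracketI T T))).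
  exact: subvf.
exact: complemented_kperp_derived.
Qed.

End RadicalNilpotent.

(** * Metric Lie algebras *)

Section Metric.
Variables (K : fieldType) (g : metricLieAlgebra K).
Implicit Types (I J : ideal g) (U W : {vspace g}).
Local Notation perpv := (orthov (@metric K g)).
Local Notation Rs := (radical_series (adjoint g)).
Local Notation Ss := (socle_series (adjoint g)).

Lemma perpvK U : perpv (perpv U) = U.
Proof. exact/orthovK/metric_nondegenerate. Qed.

Lemma perpvS U W : (U <= W)%VS -> (perpv W <= perpv U)%VS.
Proof.
move=> /subvP UW; apply/subvP => x /mem_orthovP xW; apply/mem_orthovP => y yU.
exact/xW/UW.
Qed.

Lemma perpvD U W : perpv (U + W) = (perpv U :&: perpv W)%VS.
Proof.
apply/eqP; rewrite eqEsubv subv_cap !perpvS ?addvSl ?addvSr //=.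
apply/subvP => x /memv_capP [/mem_orthovP xU /mem_orthovP xW].
apply/mem_orthovP => y /memv_addP [u uU [w wW ->]].
by rewrite linearDr /= xU // xW // addr0.
Qed.

Lemma perpvI U W : perpv (U :&: W) = (perpv U + perpv W)%VS.
Proof. by rewrite -[RHS]perpvK perpvD !perpvK. Qed.

(** Taking orthogonals is an order-reversing involution that exchanges sums and intersections. *)
Lemma complemented_perp I J :
  complemented (M := adjoint g) I J ->
  complemented (M := adjoint g) (perp J) (perp I).
Proof.
move=> cIJ W JW WI.
have [|| W' [IW' W'J WW'J WW'I]] := cIJ (perp W).
- by rewrite -[X in (X <= _)%VS]perpvK; exact: perpvS.
- by rewrite -[X in (_ <= X)%VS]perpvK; exact: perpvS.
exists (perp W'); split; try exact: perpvS.
  by rewrite -[X in (X + _)%VS]perpvK -perpvI /= WW'I.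
by rewrite -[X in (X :&: _)%VS]perpvK -perpvD /= WW'J.
Qed.

(** Duality turns semisimple subquotients into semisimple ones, so the minimality of R_(k+1) and the
    maximality of S_(k+1) give the two inclusions. *)
Lemma radical_series_perp k : Rs k = perp (Ss k) :> {vspace g}.
Proof.
elim: k => [|k IH].
  by rewrite /= orthov0.
have RE : perp (Rs k) = Ss k :> {vspace g} by rewrite /= IH /= perpvK.
apply/eqP; rewrite eqEsubv; apply/andP; split.
  apply: (@radical_series_min _ _ (adjoint g)).
    by rewrite IH; apply: perpvS; exact: (@socle_seriesS _ _ (adjoint g) k).
  exact: complemented_eq
    (complemented_perp (@socle_series_complemented _ _ _ k)) _ (esym IH).
rewrite -[X in (_ <= X)%VS]perpvK; apply: perpvS.
apply: (@socle_series_max _ _ (adjoint g) k (perp (Rs k.+1))).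
  by rewrite -RE; apply: perpvS; exact: (@radical_seriesS _ _ (adjoint g) k).
exact: complemented_eq
  (complemented_perp (@radical_series_complemented _ _ _ k)) RE _.
Qed.

Lemma socle_series_homo k l : (k <= l)%N -> (Ss k <= Ss l)%VS.
Proof.
apply: (@homo_leq _ (fun k => Ss k : {vspace g}) (fun U W => U <= W)%VS).
- exact: subvv.
- by move=> V U W; exact: subv_trans.
by move=> j; exact: (@socle_seriesS _ _ (adjoint g) j).
Qed.

Local Notation I0 := (canonical_ideal g).

Lemma mem_canonical_ideal k x : x \in Rs k.+1 -> x \in Ss k.+1 ->
  x \in (I0 : {vspace g}).
Proof.
by move=> xR xS; apply: mem_setspan; exists k; rewrite memv_cap xR xS.
Qed.

(** Two generators with indices k <= l are orthogonal, since S_k <= S_l and S_l is orthogonal to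
    R_l. *)
Lemma canonical_isotropic : isotropic I0.
Proof.
have RS k x y : x \in Ss k -> y \in Rs k -> metric x y = 0.
  by rewrite radical_series_perp symC => xS /mem_orthovP; apply.
apply/setspan_subvP => x [k /memv_capP [xR xS]].
suff /subvP Ix : (I0 <= perpv <[x]>)%VS.
  apply/mem_orthovP => y /Ix /mem_orthovP yx.
  by rewrite symC yx ?memv_line.
apply/setspan_subvP => y [l /memv_capP [yR yS]].
apply/mem_orthovP => _ /vlineP [a ->]; rewrite linearZr /=.
suff -> : metric y x = 0 by rewrite mulr0.
have [kl|/ltnW lk] := leqP k l.
  by rewrite symC; apply: RS yR; apply: (subvP (socle_series_homo _)) xS.
by apply: RS xR; apply: (subvP (socle_series_homo _)) yS.
Qed.

Lemma perp_canonical_sub k : (perp I0 <= Rs k + Ss k)%VS.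
Proof.
case: k => [|k]; first exact: subv_trans (subvf _) (addvSl _ _).
suff -> : (Rs k.+1 + Ss k.+1 = perpv (Rs k.+1 :&: Ss k.+1))%VS.
  apply: perpvS; apply/subvP => x /memv_capP [xR xS].
  exact: mem_canonical_ideal xR xS.
by rewrite perpvI radical_series_perp /= perpvK addvC.
Qed.

(* Modularity: the intersection of the [R_(k+1) + S_k] up to [m] is contained in
   [sum_(k <= m) (R_k :&: S_k) + R_(m+1)]. *)
Lemma mem_canonical_ideal_cap x :
  (forall k, x \in (Rs k.+1 + Ss k)%VS) -> x \in (I0 : {vspace g}).
Proof.
move=> xRS.
have key m : exists a, [/\ a \in (I0 : {vspace g}), a \in Ss m & x - a \in Rs m.+1].
  elim: m => [|m [a [aI aS xaR]]].
    exists 0; rewrite !mem0v subr0; split=> //.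
    by have := xRS 0%N; rewrite addv0.
  have /memv_addP [r rR [s sS xE]] := xRS m.+1.
  have sa : s - a \in (I0 : {vspace g}).
    apply: (@mem_canonical_ideal m).
      have -> : s - a = (x - a) - r by rewrite xE [r + s]addrC addrAC addrK.
      by rewrite rpredB // (subvP (@radical_seriesS _ _ (adjoint g) _)).
    by rewrite rpredB // (subvP (@socle_seriesS _ _ (adjoint g) _)).
  exists s; split=> //; first by rewrite -(subrK a s) rpredD.
  by rewrite xE addrK.
have [n Rn0] := radical_series_eventually0 (adjoint g).
have [a [aI _ xaR]] := key n.
have : x - a \in Rs n by rewrite (subvP (@radical_seriesS _ _ (adjoint g) _)).
by rewrite Rn0 memv0 subr_eq0 => /eqP ->.
Qed.

Lemma nondegenerate_capP J : nondegenerate_on J <-> (J :&: perp J = 0)%VS.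
Proof.
split=> [nJ|J0 x xJ xJ0].
  apply/eqP; rewrite -subv0; apply/subvP => x /memv_capP [xJ /mem_orthovP xp].
  by rewrite memv0 (nJ x) // => y yJ; exact: xp.
by apply/eqP; rewrite -memv0 -J0 memv_cap xJ /=; apply/mem_orthovP.
Qed.

Lemma addv_perp J : (J :&: perp J = 0)%VS -> (J + perp J = fullv)%VS.
Proof.
move=> J0; apply/eqP; rewrite eqEsubv subvf -[X in (_ <= X)%VS]perpvK perpvD.
suff -> : (perpv J :&: perpv (perp J) = 0)%VS by rewrite orthov0 subvv.
by rewrite /= perpvK capvC.
Qed.

Lemma bracket_perp0 J x y : (J :&: perp J = 0)%VS ->
  x \in (J : {vspace g}) -> y \in (perp J : {vspace g}) -> [lie x, y] = 0.
Proof.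
move=> J0 xJ yJ; apply/eqP; rewrite -memv0 -J0 memv_cap ideal_stabler //=.
exact: (ideal_stable (I := perp J)).
Qed.

Definition minimal_ideal I := forall J, (J <= I)%VS ->
  (J = 0 :> {vspace g})%VS \/ (J = I :> {vspace g}).

(* [I] is not isotropic, so [g] is the sum of [I] and [perp I], which commute, and
   the ideals of [I] are ideals of [g]. *)
Lemma minimal_ideal_simple I : minimal_ideal I -> ~ abelian I ->
  simple_lie (sub_lie I).
Proof.
move=> mI nab.
have I0 : (I :&: perp I = 0)%VS.
  have [//|Ip] := mI (submoduleI I (perp I)) (capvSl _ _).
  (* If [I] were isotropic, then <[x, y], z> = <x, [y, z]> = 0 for all z, because [y, z] is in
     [I]. *)
  case: nab => x y xI yI; apply/eqP; rewrite -memv0 -(eqP (metric_nondegenerate g)).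
  apply/mem_orthovP => z _; rewrite metric_invariant symC.
  have /memv_capP [_ /mem_orthovP xp] : x \in (submoduleI I (perp I) : {vspace g}).
    by rewrite Ip.
  rewrite symC xp // ideal_stabler //.
split=> [ab|J].
  apply: nab => x y xI yI.
  have := ab (vsproj I x) (vsproj I y) (memvf _) (memvf _).
  move/(congr1 vsval); rewrite [LHS]val_sub_bracket !vsprojK //.
pose f : 'Hom(sub_lie I, g) := linfun vsval.
have f0 : lker f == 0%VS.
  by apply/lker0P => u w; rewrite !lfunE /=; exact: subvs_inj.
have Js x y : y \in (f @: J)%VS -> [lie x, y] \in (f @: J)%VS.
  move=> /memv_imgP [u uJ ->]; rewrite lfunE /=.
  have : x \in (I + perp I)%VS by rewrite addv_perp // memvf.
  move=> /memv_addP [a aI [b bI ->]]; rewrite linearDl /=.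
  rewrite [X in _ + X]bracketC (bracket_perp0 I0 (subvsP u) bI) oppr0 addr0.
  have -> : [lie a, vsval u] = f [lie (vsproj I a : sub_lie I), (u : sub_lie I)].
    by rewrite lfunE /= [RHS]val_sub_bracket vsprojK.
  exact/memv_img/ideal_stable.
pose J' : ideal g := @Submodule _ _ (adjoint g) _ Js.
have J'I : (J' <= I)%VS.
  by apply/subvP => _ /memv_imgP [u _ ->]; rewrite lfunE subvsP.
have [J'0|J'E] := mI J' J'I.
  left; apply/eqP; rewrite -(eq_limg_ker0 _ _ f0) limg0; exact/eqP.
right; apply/eqP; rewrite -(eq_limg_ker0 _ _ f0); apply/eqP; rewrite [LHS]J'E.
apply/vspaceP => x; apply/idP/memv_imgP => [xI|[u _ ->]]; last by rewrite lfunE subvsP.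
by exists (vsproj I x); rewrite ?memvf // lfunE /= vsprojK.
Qed.

End Metric.

(** * The socle in the absence of simple ideals *)

Section NoSimpleIdeals.
Variables (K : fieldType) (g : metricLieAlgebra K).
Hypothesis nosimple : ~ exists S : ideal g, simple_lie (sub_lie S).
Local Notation S1 := (socle_series (adjoint g) 1).

(** Otherwise [S_1, S_1] contains a minimal ideal [I], abelian by hypothesis, with an ideal [W] as
    complement in S_1. Since [I, I] = [I, W] = 0, the ideal [S_1, S_1] lies in [W], and so does [I],
    a contradiction. *)
Lemma socle_abelian : abelian (S1 : {vspace g}).
Proof.
suff D0 : bracketI S1 S1 = 0%VS :> {vspace g}.
  by move=> x y xS yS; apply/eqP; rewrite -memv0 -D0; exact: mem_bracketv.
apply: contrapT => D0.
have [I [ID I0] Imin] := @exists_mindim _ _ (adjoint g)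
  (fun U => (U <= bracketI S1 S1)%VS /\ (U <> 0 :> {vspace g})%VS) _
  (conj (subvv _) D0).
have mI : minimal_ideal I.
  move=> J JI; have [->|J0] := pselect (J = 0 :> {vspace g})%VS; first by left.
  right; apply/eqP; rewrite eqEdim JI Imin //; split=> //.
  exact: subv_trans JI ID.
have abI : abelian I.
  by apply: contrapT => /(minimal_ideal_simple mI) sI; apply: nosimple; exists I.
have IS : (I <= S1)%VS by apply: subv_trans ID _; exact: bracketv_ideal.
have [|W [_ WS IWS IW0]] := @socle_series_complemented _ _ (adjoint g) 0 I _ IS.
  exact: sub0v.
have IW0' : (I :&: W = 0)%VS := IW0.
have WI x y : x \in (I : {vspace g}) -> y \in (W : {vspace g}) -> [lie x, y] = 0.
  by move=> xI yW; apply/eqP; rewrite -memv0 -IW0' memv_cap ideal_stabler // ideal_stable.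
suff DW : (bracketI S1 S1 <= W)%VS.
  apply: I0; apply/eqP; rewrite -subv0 -IW0' subv_cap subvv.
  exact: subv_trans ID DW.
apply/bracketv_subvP => x y; rewrite -IWS.
move=> /memv_addP [a aI [b bW ->]] /memv_addP [c cI [d dW ->]].
rewrite linearDl !linearDr /= abI // WI // [[lie b, c]]bracketC WI // oppr0.
by rewrite !add0r ideal_stable.
Qed.

Lemma socle_nilact : nilact (S1 : {vspace g}).
Proof.
exists 2; apply/eqP; rewrite -subv0; apply/bracketv_subvP => x y xS yS.
rewrite memv0 socle_abelian //; apply: subvP yS.
by apply/bracketv_subvP => u v uS _; exact: (ideal_stabler (I := S1)).
Qed.

End NoSimpleIdeals.

(** * Commutativity of the canonical subquotient *)

Section CanonicalExtension.
Variables (R : rcfType) (g : metricLieAlgebra R).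
Hypothesis nosimple : ~ exists S : ideal g, simple_lie (sub_lie S).
Local Notation Rs := (radical_series (adjoint g)).
Local Notation Ss := (socle_series (adjoint g)).

Lemma perp_canonical_radical k x y :
  x \in (perp (canonical_ideal g) : {vspace g}) -> y \in Rs k ->
  [lie x, y] \in Rs k.+1.
Proof.
move=> /(subvP (perp_canonical_sub g 1)) /memv_addP [r r1 [s s1 ->]] yk.
have cR := @radical_series_complemented _ _ (adjoint g) k.
have RS := @radical_seriesS _ _ (adjoint g) k.
rewrite linearDl rpredD //=.
  apply: (subvP (nilact_complemented (radical_series1_nilact g) RS cR)).
  exact: mem_bracketv.
apply: (subvP (nilact_complemented (socle_nilact nosimple) RS cR)).
exact: mem_bracketv.
Qed.

(** For every k, y is in R_k + S_k. Bracketing with x moves the first part into R_(k+1) and keeps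
    the second in the ideal S_k, as [mem_canonical_ideal_cap] requires. *)
Lemma perp_canonical_bracket x y :
  x \in (perp (canonical_ideal g) : {vspace g}) ->
  y \in (perp (canonical_ideal g) : {vspace g}) ->
  [lie x, y] \in (canonical_ideal g : {vspace g}).
Proof.
move=> xj yj; apply: mem_canonical_ideal_cap => k.
have /memv_addP [r rR [s sS ->]] := subvP (perp_canonical_sub g k) _ yj.
rewrite linearDr memv_add //=; first exact: perp_canonical_radical.
exact: ideal_stable.
Qed.

Lemma perp_quot_canonical_abelian : abelian (perp_quot (canonical_ideal g)).
Proof.
move=> _ _ /memv_imgP [x xj ->] /memv_imgP [y yj ->].
rewrite -[LHS]/(quot_bracket _ _) quot_bracketE.
apply/eqP; rewrite quotp_eq0; exact: perp_canonical_bracket.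
Qed.

End CanonicalExtension.

Section QuadraticExtension.
Variables (K : fieldType) (g : metricLieAlgebra K) (I : ideal g).
Variables (iso : isotropic I) (ab : abelian (perp_quot I)).

Lemma perp_quadratic_extension :
  quadratic_extension (perp_module iso ab) I (perp_incl iso ab) (perp_proj I).
Proof.
have iE (a : perp_module iso ab) : perp_incl iso ab a = vsval a.
  by rewrite lfunE.
have limg_i : limg (perp_incl iso ab) = perp_quot I :> {vspace quot_lie I}.
  apply/vspaceP => u; apply/memv_imgP/idP => [[a _ ->]|uP].
    by rewrite iE subvsP.
  by exists (vsproj (perp_quot I) u); rewrite ?memvf // iE vsprojK.
split=> //.
- by move=> a b; rewrite !iE; apply: ab; exact: subvsP.
- move=> u v; rewrite -(quot_liftK u) -(quot_liftK v).
  rewrite -[X in perp_proj I X]/(quot_bracket _ _) quot_bracketE !(perp_projE iso).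
  by rewrite -[RHS]/(quot_bracket _ _) quot_bracketE.
- by apply/eqP/lker0P => a b; rewrite !iE; exact: subvs_inj.
- rewrite limg_i; apply/vspaceP => u; rewrite memv_ker -(quot_liftK u).
  rewrite (perp_projE iso) quotp_eq0; apply/memv_imgP/idP => [[x xP /quotpP xu]|uP].
    by rewrite -(subrK x (quot_lift I u)) rpredD // (subvP iso).
  by exists (quot_lift I u).
- apply/eqP; rewrite eqEsubv subvf; apply/subvP => u _.
  by rewrite -(quot_liftK u) -(perp_projE iso) memv_img ?memvf.
- move=> l a l' <-; rewrite !iE -(quot_liftK l') (perp_projE iso).
  exact: val_perp_action.
move=> a b x y xP yP; rewrite !iE => xa yb.
by apply/esym/perp_formE.
Qed.

End QuadraticExtension.

(** * The centre and non-degenerate abelian ideals *)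

Section AbelianIdeals.
Variables (R : numFieldType) (g : metricLieAlgebra R).

(** Any y orthogonal to [derived g] is central, since <[y, z], w> = <y, [z, w]> = 0. So x is in the
    double orthogonal of [derived g]. *)
Lemma center_perp_derived (x : g) :
  (forall y : g, center g y -> metric x y = 0) -> x \in derived g.
Proof.
move=> xc; rewrite -(perpvK (derived g)); apply/mem_orthovP => y /mem_orthovP yd.
apply: xc => z; apply/eqP; rewrite -memv0 -(eqP (metric_nondegenerate g)).
apply/mem_orthovP => w _; rewrite metric_invariant yd //.
by apply: mem_setspan; exists z, w.
Qed.

Lemma derived_center_perp (x y : g) :
  x \in derived g -> center g y -> metric x y = 0.
Proof.
move=> xd yc; have /subvP dy : (derived g <= orthov metric <[y]>)%VS.
  apply/setspan_subvP => _ [a [b ->]]; apply/mem_orthovP => _ /vlineP [c ->].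
  by rewrite linearZr /= metric_invariant bracketC yc oppr0 linear0r mulr0.
by have /mem_orthovP := dy x xd; apply; exact: memv_line.
Qed.

Lemma center_sub_derivedP :
  (forall x : g, center g x -> x \in derived g) <->
  ~ exists J : ideal g,
      [/\ (J <> 0 :> {vspace g})%VS, nondegenerate_on J & abelian J].
Proof.
split=> [zd [J [J0 ndJ abJ]]|noJ x xc].
  have Jp := (nondegenerate_capP J).1 ndJ.
  (* [J] commutes with itself and with [perp J], and their sum is everything. *)
  have Jc x : x \in (J : {vspace g}) -> center g x.
    move=> xJ y; have : y \in (J + perp J)%VS by rewrite addv_perp ?memvf.
    move=> /memv_addP [a aJ [b bJ ->]].
    by rewrite linearDr /= abJ // (bracket_perp0 Jp) // addr0.
  apply: J0; apply/eqP; rewrite -subv0; apply/subvP => x xJ.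
  rewrite memv0 (ndJ x) // => y yJ.
  exact: derived_center_perp (zd _ (Jc _ xJ)) (Jc _ yJ).
apply: center_perp_derived => y yc; apply: contrapT => xy.
(* Polarisation: if x and y are both isotropic, then <x + y, x + y> = 2 <x, y>, which is non-zero in
   characteristic 0. *)
have [v vc vv] : exists2 v : g, center g v & metric v v != 0.
  have [xx|/negPn/eqP xx] := boolP (metric x x != 0); first by exists x.
  have [yy|/negPn/eqP yy] := boolP (metric y y != 0); first by exists y.
  exists (x + y); first by move=> z; rewrite linearDl /= xc yc addr0.
  rewrite linearDl !linearDr /= xx yy [metric y x]symC add0r addr0.
  by rewrite -mulr2n mulrn_eq0 negb_or; apply/eqP.
apply: noJ.
have vs z w : w \in (<[v]>)%VS -> [lie z, w] \in (<[v]>)%VS.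
  move=> /vlineP [c ->]; rewrite linearZr /= bracketC vc oppr0 scaler0.
  exact: mem0v.
exists (@Submodule _ _ (adjoint g) _ vs); split=> /=.
- move=> v0; have : v \in (0 : {vspace g})%VS by rewrite -v0 memv_line.
  by rewrite memv0 => /eqP v0'; rewrite v0' linear0l eqxx in vv.
- move=> _ /vlineP [c ->] /(_ v (memv_line v)) /eqP.
  by rewrite linearZl_LR /= mulf_eq0 (negPf vv) orbF => /eqP ->; rewrite scale0r.
by move=> _ z /vlineP [c ->] _; rewrite linearZl_LR /= vc scaler0.
Qed.

End AbelianIdeals.

Theorem proposition4p1 (R : realType) (g : metricLieAlgebra R)
    (nosimple : ~ exists S : ideal g, simple_lie (sub_lie S)) :
  exists (iso : isotropic (canonical_ideal g))
         (ab : abelian (perp_quot (canonical_ideal g))),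
    balanced (perp_module iso ab) (canonical_ideal g)
             (perp_incl iso ab) (perp_proj (canonical_ideal g)) /\
    (regularly_balanced (perp_module iso ab) (canonical_ideal g)
             (perp_incl iso ab) (perp_proj (canonical_ideal g)) <->
     ~ exists J : ideal g,
         [/\ (J <> 0 :> {vspace g})%VS, nondegenerate_on J & abelian J]).
Proof.
exists (canonical_isotropic g), (perp_quot_canonical_abelian nosimple).
have bal := conj (perp_quadratic_extension (canonical_isotropic g)
  (perp_quot_canonical_abelian nosimple)) (erefl (canonical_ideal g : {vspace g})).
split=> //; split=> [[_ zd]|noJ]; first exact/center_sub_derivedP.
by split=> //; exact/center_sub_derivedP.
Qed.
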